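(* Let $1\le n_0<n$ and let $\xi_1,\ldots,\xi_n$ be independent random variables with finite moments of all positive orders, where $\xi_1,\ldots,\xi_{n_0}$ are nonnegative and $\xi_{n_0+1},\ldots,\xi_n$ take values in $\mathbb{R}$. Assume that all the distribution functions $F_i$ of $\xi_i$, $i=1,\ldots,n$, are absolutely continuous, with densities $f_i$. Assume further that $f_i(x)>0$ on $(0,\infty)$ for $i=1,\ldots,n_0$, while for $j=n_0+1,\ldots,n$ one has $f_j(x)>0$ on $\mathbb{R}$ and $f_j$ is symmetric (about $0$). Suppose also that the following conditions hold: (i) At least one of the densities $f_j(x)$, $j=n_0+1,\ldots,n$, is decreasing in $x\ge x_0$, where $x_0\ge 1$ is a constant. (ii) For each $i=1,2,\ldots,n$, there exists a constant $A_i>0$ such that, with $\overline{F_i}=1-F_i$, $$\frac{f_i(x)}{\overline{F_i}(x)}\ge \frac{A_i}{x}\quad\text{for } x\ge x_0,$$ and there exist constants $B_i>0$, $\alpha_i>0$, $\beta_i>0$ and real $\gamma_i$ such that $$\overline{F_i}(x)\ge B_i x^{\gamma_i}e^{-\alpha_i x^{\beta_i}}\quad\text{for } x\ge x_0.$$ If, in addition to (i) and (ii), the parameters $\beta_i$ are such that $\sum_{i=1}^n\frac{1}{\beta_i}>1$, then the product $Z_n=\xi_1\cdots\xi_n$ is M-indet.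
   Context: A random variable $X$ with distribution function $F$ and moments $m_k=\mathbf{E}[X^k]$ (all finite) is called moment determinate (M-det) if $F$ is the only distribution having the moment sequence $\{m_k\}_{k=1}^\infty$; otherwise it is called moment indeterminate (M-indet). *)

(* Defs.v *)
From HB Require Import structures.
From mathcomp Require Import all_boot all_order all_algebra.
From mathcomp Require Import all_classical all_reals all_analysis.

Set Implicit Arguments.
Unset Strict Implicit.
Unset Printing Implicit Defensive.

Import Order.TTheory GRing.Theory Num.Theory.
Import numFieldNormedType.Exports.

Local Open Scope classical_set_scope.
Local Open Scope ring_scope.

(* For a finite family the product rule over the whole index set suffices:
   the rule for a subfamily is obtained by taking the other events to be
   [setT]. *)
Definition mutually_independent (d : measure_display) (T : measurableType d)
    (R : realType) (P : probability T R) (I : finType)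
    (X : I -> {RV P >-> R}) : Prop :=
  forall A : I -> set R, (forall i, measurable (A i)) ->
    P (\bigcap_i (X i @^-1` A i)) = (\prod_(i : I) P (X i @^-1` A i))%E.

Definition has_density (d : measure_display) (T : measurableType d)
    (R : realType) (P : probability T R) (X : {RV P >-> R})
    (f : R -> R) : Prop :=
  [/\ measurable_fun setT f,
      forall x, 0 <= f x &
      forall r, cdf X r = (\int[lebesgue_measure]_(x in `]-oo, r]) (f x)%:E)%E].

Definition finite_moments (d : measure_display) (T : measurableType d)
    (R : realType) (P : probability T R) (X : T -> R) : Prop :=
  forall k : nat, P.-integrable setT (fun w => (X w ^+ k)%:E).

Definition moment (d : measure_display) (T : measurableType d)
    (R : realType) (P : probability T R) (X : T -> R) (k : nat) : \bar R :=
  'E_P[fun w => X w ^+ k].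

(* Distributions are represented by probability measures [nu] on the Borel sets
   of R; the moments of [nu] are those of the identity function under [nu].
   Here X is a bare function: its measurability is part of [finite_moments]
   (case k = 1). *)
Definition M_det (d : measure_display) (T : measurableType d)
    (R : realType) (P : probability T R) (X : T -> R) : Prop :=
  finite_moments P X /\
  forall nu : probability R R,
    finite_moments nu (fun x : R => x) ->
    (forall k, (1 <= k)%N -> moment nu (fun x : R => x) k = moment P X k) ->
    forall A : set R, measurable A -> nu A = pushforward P X A.

(* Both notions only concern random variables with all moments finite. *)
Definition M_indet (d : measure_display) (T : measurableType d)
    (R : realType) (P : probability T R) (X : T -> R) : Prop :=
  finite_moments P X /\ ~ M_det P X.

(* Main.v *)
Require Import Defs.
From HB Require Import structures.
From mathcomp Require Import all_boot all_order all_algebra.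
From mathcomp Require Import all_classical all_reals all_analysis.
From mathcomp Require Import measurable_realfun lra ring zify.

Set Implicit Arguments.
Unset Strict Implicit.
Unset Printing Implicit Defensive.

Import Order.TTheory GRing.Theory Num.Theory.
Import numFieldNormedType.Exports.

Local Open Scope classical_set_scope.
Local Open Scope ring_scope.

(** The law of the product Z is indeterminate because a nonzero signed measure
    with all moments zero can be added to it without destroying positivity.

    Such a signed measure is built from finite interpolation sums. For nodes
    u_0 < u_1 < ..., evaluating at 0 the Lagrange interpolant of x^m on the
    first N nodes gives
    [sum_(k < N) u_k^m prod_(j < N, j <> k) 1 / (1 - u_k / u_j) = 0]
    for 0 < m < N. The weights alternate in sign, so the even and the odd nodes
    balance each other, and their absolute values increase with N; with
    [u_k = (k + 1)^q] and q > 2 they are at most [2 (2 / q)^k]. Indeed for q = 2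
    they have a closed form bounded by 2, and by the Bernoulli inequality each of
    the k factors with j < k is multiplied by at most 2 / q when the exponent 2
    is replaced by q. Monotone convergence in N then yields weights w_k that decay geometrically, with
    [sum_(k even) w_k u_k^m = sum_(k odd) w_k u_k^m] for all m > 0
    ([exists_balanced_weights]).

    Put [t_k = L sqrt(u_k)], and let [mu_t] be the image of Lebesgue measure on
    [1 <= |x| <= 2] under multiplication by t. The mixtures of the [mu_(t_k)]
    with weights proportional to [w_k u_k], over the even and over the odd k, are
    symmetric and have the same even moments, hence the same moments, but they
    differ near the smallest node. If the odd mixture Mn lies below the law of Z,
    then replacing Mn by the even mixture Mp in that law gives a second
    probability measure with the moments of Z ([M_indet_of_equal_moments]).
    For Mn to lie below the law of Z it suffices that this law dominates
    [c exp (- C t^b) mu_t] for large t and some b < 1, because q can be taken with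
    q b / 2 < 1 and then geometric decay in k beats [exp (C t_k^b)]
    ([M_indet_of_dilate_minorant]).

    This lower bound holds with [1 / b = sum_i 1 / beta_i]
    ([dilate_prod_minorant]). Let xi_j be a symmetric factor whose density is
    eventually decreasing, and let [a_i = t^(b / beta_i)], so that the product of the a_i is t. Keep each
    other factor in ]a_i, 2 a_i]; by the hazard rate condition this has
    probability at least [A_i / 2] times the tail at [2 a_i]. Given the other
    factors, Z is a multiple of xi_j by a number comparable to [t / a_j], and on
    the relevant range the density of xi_j is at least its value at [2 a_j],
    which the hazard rate condition again compares with the tail. Each tail at
    [2 a_i] is at least [exp (- C_i t^b)] up to a constant. *)

(** * Weights of Lagrange interpolation at zero *)

(** Value at 0 of the k-th Lagrange basis polynomial for the nodes
    u_0, ..., u_(N-1). *)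
Definition lagrange_weight (F : fieldType) (u : nat -> F) (N k : nat) : F :=
  \prod_(j < N | j != k :> nat) (1 - u k / u j)^-1.

(** Interpolation on N nodes is exact for the polynomial x^m, which vanishes
    at 0. *)
Lemma lagrange_weight_moment (F : fieldType) (u : nat -> F) (N m : nat) :
  injective u -> (forall k, u k != 0) -> (0 < m < N)%N ->
  \sum_(k < N) lagrange_weight u N k * u k ^+ m = 0.
Proof.
move=> u_inj u_neq0 /andP[m_gt0 mN].
pose ell (k : 'I_N) : {poly F} :=
  \prod_(j < N | j != k) ((u k - u j)^-1 *: ('X - (u j)%:P)).
have sub_neq0 (j k : 'I_N) : j != k -> u k - u j != 0.
  by apply: contra_neq => /subr0_eq /u_inj /val_inj.
have size_ell k : (size (ell k) <= N)%N.
  rewrite (leq_trans (size_poly_prod_leq _ _))//.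
  rewrite (eq_bigr (fun=> 2%N)); last first.
    move=> j jk; rewrite size_scale ?size_XsubC//.
    by rewrite invr_eq0 sub_neq0.
  have := cardC1 k; rewrite card_ord => cN.
  rewrite sum_nat_const; have := ltn_ord k; move: cN; set c := #|_|; lia.
have ell_node (k i : 'I_N) : (ell k).[u i] = (i == k)%:R.
  rewrite horner_prod; case: eqP => [->|/eqP ik].
    rewrite big1// => j jk.
    by rewrite hornerZ hornerXsubC mulVf// sub_neq0.
  by rewrite (bigD1 i)//= hornerZ hornerXsubC subrr mulr0 mul0r.
(* The error of interpolation: it has N roots and degree less than N. *)
pose p := 'X^m - \sum_(k < N) (u k ^+ m) *: ell k.
have /(congr1 (fun p => p.[0])) : p = 0.
  apply: (@roots_geq_poly_eq0 _ _ [seq u i | i <- iota 0 N]).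
  - apply/allP => _ /mapP[i + ->]; rewrite mem_iota add0n => /andP[_ iN].
    rewrite rootE /p hornerD hornerN hornerXn horner_sum.
    rewrite (bigD1 (Ordinal iN))//= big1 => [|k ik].
      rewrite hornerZ (ell_node (Ordinal iN) (Ordinal iN)) eqxx.
      by rewrite mulr1 addr0 subrr.
    by rewrite hornerZ (ell_node k (Ordinal iN)) eq_sym (negbTE ik) mulr0.
  - by rewrite map_inj_uniq// iota_uniq.
  - rewrite size_map size_iota (leq_trans (size_polyD _ _))// geq_max.
    rewrite size_polyXn size_polyN mN /=.
    apply: (big_ind (fun q : {poly F} => size q <= N)%N).
    + by rewrite size_poly0.
    + by move=> a b aN bN; rewrite (leq_trans (size_polyD _ _))// geq_max aN.
    + by move=> k _; rewrite (leq_trans (size_scale_leq _ _)).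
rewrite /p hornerD hornerN hornerXn expr0n gtn_eqF// hornerC add0r horner_sum.
move=> /eqP; rewrite oppr_eq0 => /eqP ell0.
rewrite -[RHS]ell0; apply: eq_bigr => k _; rewrite hornerZ mulrC; congr *%R.
rewrite horner_prod /lagrange_weight; apply: eq_big => // j jk.
rewrite hornerZ hornerXsubC sub0r -[X in (X - _)^-1](divff (u_neq0 j)) -mulrBl.
by rewrite invfM invrK mulrN -mulNr -invrN opprB.
Qed.

(** * Interpolation weights at the squares *)

Lemma big_ord_recr_neq (R : comPzRingType) (F : nat -> R) (N k : nat) :
  \prod_(j < N.+1 | j != k :> nat) F j =
  (\prod_(j < N | j != k :> nat) F j) * (if N != k then F N else 1).
Proof. by rewrite big_mkcond big_ord_recr /= -big_mkcond. Qed.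

Lemma big_ord_neq_max (R : comPzRingType) (F : nat -> R) (k : nat) :
  \prod_(j < k.+1 | j != k :> nat) F j = \prod_(j < k) F j.
Proof.
rewrite big_ord_recr_neq eqxx mulr1; apply: eq_bigl => j.
by rewrite ltn_eqF.
Qed.

(** The gaps between squares factor, which makes the product of all of them a
    ratio of factorials. *)
Lemma square_gap_inv (R : realFieldType) (j k : nat) : j != k ->
  `|1 - (k.+1%:R / j.+1%:R) ^+ 2|^-1 =
  j.+1%:R ^+ 2 / (`|k%:R - j%:R| * (k + j).+2%:R) :> R.
Proof.
move=> jk.
have j1 : j.+1%:R != 0 :> R by rewrite pnatr_eq0.
have -> : 1 - (k.+1%:R / j.+1%:R) ^+ 2 =
  (j%:R - k%:R) * (k + j).+2%:R / j.+1%:R ^+ 2 :> R.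
  rewrite -[(k + j).+2]addn2 -[k.+1]addn1 -[j.+1]addn1 !natrD; field.
  by rewrite natr1.
rewrite !normrM distrC normr_nat normfV normrX normr_nat.
by rewrite invf_div.
Qed.

Lemma prod_fact (R : comPzRingType) (k : nat) :
  \prod_(j < k) j.+1%:R = k`!%:R :> R.
Proof. by rewrite fact_prod natr_prod big_add1 big_mkord. Qed.

(** The contribution of the nodes below k: the factors k - j multiply to k!
    and the factors k + j + 2 to (2 k + 1)! / (k + 1)!. *)
Lemma square_weight_base (R : realFieldType) (k : nat) :
  (\prod_(j < k) `|1 - (k.+1%:R / j.+1%:R) ^+ 2|^-1) * (k.*2.+2)`!%:R =
  2 * (k.+1)`!%:R ^+ 2 :> R.
Proof.
rewrite (eq_bigr (fun j : 'I_k =>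
  j.+1%:R ^+ 2 / ((k - j)%:R * (k + j).+2%:R))); last first.
  move=> j _; rewrite square_gap_inv ?ltn_eqF// natrB ?(ltnW (ltn_ord _))//.
  by rewrite ger0_norm// subr_ge0 ler_nat ltnW.
rewrite big_split /= prodrXl prod_fact prodfV big_split /=.
have -> : \prod_(i < k) (k - i)%:R = k`!%:R :> R.
  by rewrite -natr_prod -ffact_prod ffactnn.
pose Q : R := \prod_(i < k) (k + i).+2%:R.
have Q0 : Q != 0 by rewrite prodf_seq_neq0; apply/allP => i _; rewrite pnatr_eq0.
have QE : Q * (k.+1)`!%:R = (k.*2.+1)`!%:R.
  have kk : (k <= k.*2.+1)%N by lia.
  rewrite -(ffact_fact kk) natrM ffact_prod natr_prod; congr (_ * _`!%:R); last lia.
  rewrite /Q (reindex_inj rev_ord_inj); apply: eq_bigr => i _ /=.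
  by congr (_%:R); have := ltn_ord i; lia.
have k0 : k`!%:R != 0 :> R by rewrite pnatr_eq0 -lt0n fact_gt0.
rewrite factS natrM -QE -/Q factS natrM.
have -> : k.*2.+2%:R = 2 * k.+1%:R :> R by rewrite -natrM; congr (_%:R); lia.
field; rewrite Q0 /=; exact: k0.
Qed.

(** By induction on the number of nodes; each node above k multiplies both
    sides by the same ratio. *)
Lemma square_weightE (R : realFieldType) (N k : nat) : (k < N)%N ->
  (\prod_(j < N | j != k :> nat) `|1 - (k.+1%:R / j.+1%:R) ^+ 2|^-1) *
    ((N - k.+1)`!%:R * (N + k.+1)`!%:R) = 2 * N`!%:R ^+ 2 :> R.
Proof.
elim: N => // N IH; rewrite ltnS leq_eqVlt => /predU1P[->|kN].
  rewrite (big_ord_neq_max (fun j => `|1 - (_ / j.+1%:R) ^+ 2|^-1)) subnn mul1r.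
  by rewrite -square_weight_base; congr (_ * _`!%:R); lia.
rewrite (big_ord_recr_neq (fun j => `|1 - (_ / j.+1%:R) ^+ 2|^-1)).
rewrite gtn_eqF//= square_gap_inv ?gtn_eqF//.
rewrite -[_ - _]opprB normrN ger0_norm; last by rewrite subr_ge0 ler_nat ltnW.
rewrite -natrB ?(ltnW kN)// subSS addSn factS [X in _ = X](_ : _ = 
  N.+1%:R ^+ 2 * (2 * N`!%:R ^+ 2)); last by rewrite factS natrM; ring.
rewrite -IH// -[(N - k)%N]prednK ?subn_gt0// factS.
have -> : (N - k.+1)%N = (N - k).-1 by lia.
have -> : (k + N).+2 = (N + k.+1).+1 by lia.
rewrite !natrM; field.
by rewrite !nat1r !pnatr_eq0 /= andbT -natrD nat1r pnatr_eq0.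
Qed.

(** Log-convexity of the factorial. *)
Lemma fact_sqr_le (N m : nat) : (m <= N)%N ->
  (N`! ^ 2 <= (N - m)`! * (N + m)`!)%N.
Proof.
elim: m => [|m IH] mN; first by rewrite subn0 addn0 mulnn.
apply: (leq_trans (IH (ltnW mN))).
have -> : (N - m)`! = ((N - m) * (N - m.+1)`!)%N.
  by rewrite -[(N - m)%N]prednK ?subn_gt0// factS; congr (_ * _`!)%N; lia.
rewrite addnS factS; have : (N - m <= (N + m).+1)%N by lia.
by move=> le_factor; rewrite -mulnA mulnCA !leq_mul2l leq_mul2r le_factor !orbT.
Qed.

(** The exponent 2 is the critical one: the weights are bounded but do not
    decay. *)
Lemma square_weight_le2 (R : realFieldType) (N k : nat) : (k < N)%N ->
  \prod_(j < N | j != k :> nat) `|1 - (k.+1%:R / j.+1%:R) ^+ 2|^-1 <= 2 :> R.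
Proof.
move=> kN; have fact_gt0 : 0 < (N - k.+1)`!%:R * (N + k.+1)`!%:R :> R.
  by rewrite -natrM ltr0n muln_gt0 !fact_gt0.
rewrite -(ler_pM2r fact_gt0) square_weightE// ler_pM2l//.
by rewrite -natrX -natrM ler_nat fact_sqr_le.
Qed.

(** * Interpolation weights at larger powers, and their limits *)

Lemma prod_below (R : comPzRingType) (x : R) (N k : nat) : (k < N)%N ->
  \prod_(j < N | j != k :> nat) (if (j < k)%N then x else 1) = x ^+ k.
Proof.
elim: N => // N IH; rewrite ltnS leq_eqVlt => /predU1P[->|kN].
  rewrite (big_ord_neq_max (fun j => if (j < N)%N then x else 1)).
  rewrite (eq_bigr (fun=> x)) => [|j _]; last by rewrite ltn_ord.
  by rewrite prodr_const card_ord.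
rewrite (big_ord_recr_neq (fun j => if (j < k)%N then x else 1)) IH//.
by rewrite ltnNge (ltnW kN) /= if_same mulr1.
Qed.

(** Young's inequality for the product of y and 1. *)
Lemma powR_bernoulli (R : realType) (p y : R) : 1 < p -> 0 <= y ->
  p * (y - 1) <= y `^ p - 1.
Proof.
move=> p1 y0; have p0 : 0 < p by lra.
have pp : 0 < 1 - p^-1 by rewrite subr_gt0 invf_lt1.
have conj : p^-1 + (1 - p^-1)^-1^-1 = 1 by rewrite invrK addrC subrK.
have := conjugate_powR y0 ler01 p0 _ conj.
rewrite invr_gt0 pp invrK => /(_ erefl).
rewrite powR1 mulr1 mul1r -(ler_pM2l p0) mulrDr mulrCA divff ?gt_eqF// mulr1.
rewrite mulrBr mulr1 divff ?gt_eqF//; lra.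
Qed.

Definition power_node (R : realType) (q : R) (k : nat) : R := k.+1%:R `^ q.

Lemma power_node_gt0 (R : realType) (q : R) (k : nat) : 0 < power_node q k.
Proof. by rewrite powR_gt0. Qed.

Lemma power_node_ge0 (R : realType) (q : R) (k : nat) : 0 <= power_node q k.
Proof. exact: powR_ge0. Qed.

Lemma power_node_ratio (R : realType) (q : R) (j k : nat) :
  power_node q k / power_node q j = (k.+1%:R / j.+1%:R) `^ q.
Proof.
rewrite /power_node powRM ?invr_ge0// -[j.+1%:R^-1]powR_inv1//.
by rewrite -powRrM mulN1r powRN.
Qed.

Lemma ltr_power_node (R : realType) (q : R) (j k : nat) : 0 < q -> (j < k)%N ->
  power_node q j < power_node q k.
Proof. by move=> q0 jk; rewrite gt0_ltr_powR ?nnegrE// ltr_nat. Qed.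

Lemma power_node_inj (R : realType) (q : R) : 0 < q -> injective (power_node q).
Proof.
move=> q0 j k jk; case: (ltngtP j k) => // /(ltr_power_node q0).
  by rewrite jk ltxx.
by rewrite jk ltxx.
Qed.

(** This factor 2 / q, gained once for every node below k, is the source of
    the geometric decay of the weights. *)
Lemma power_gap_inv_below (R : realType) (q : R) (j k : nat) : 2 < q ->
  (j < k)%N ->
  `|1 - power_node q k / power_node q j|^-1 <=
  2 / q * `|1 - (k.+1%:R / j.+1%:R) ^+ 2|^-1.
Proof.
move=> q2 jk; rewrite power_node_ratio.
have x1 : 1 < k.+1%:R / j.+1%:R :> R by rewrite ltr_pdivlMr// mul1r ltr_nat.
set x : R := _ / _ in x1 *.
have x21 : 1 < x ^+ 2 by rewrite exprn_egt1.
have qx : q / 2 * (x ^+ 2 - 1) <= x `^ q - 1.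
  have -> : x `^ q = (x ^+ 2) `^ (q / 2).
    rewrite -powR_mulrn; last lra.
    by rewrite -powRrM mulrC divfK.
  by apply: powR_bernoulli; lra.
have -> : `|1 - x ^+ 2| = x ^+ 2 - 1 by rewrite distrC gtr0_norm// subr_gt0.
have gap_gt0 : 0 < q / 2 * (x ^+ 2 - 1) by apply: mulr_gt0; lra.
have -> : `|1 - x `^ q| = x `^ q - 1 by rewrite distrC gtr0_norm//; lra.
rewrite -[2 / q]invf_div -invfM lef_pV2 ?posrE//; lra.
Qed.

Lemma power_gap_inv_above (R : realType) (q : R) (j k : nat) : 2 < q ->
  (k < j)%N ->
  `|1 - power_node q k / power_node q j|^-1 <=
  `|1 - (k.+1%:R / j.+1%:R) ^+ 2|^-1.
Proof.
move=> q2 kj; rewrite power_node_ratio.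
have x1 : k.+1%:R / j.+1%:R < 1 :> R by rewrite ltr_pdivrMr// mul1r ltr_nat.
have x0 : 0 < k.+1%:R / j.+1%:R :> R by rewrite divr_gt0.
set x : R := _ / _ in x0 x1 *.
have x21 : x ^+ 2 < 1 by rewrite exprn_ilt1// ltW.
have qx : x `^ q <= x ^+ 2.
  rewrite -powR_mulrn; last lra.
  apply: ger_powR; lra.
by rewrite !gtr0_norm ?lef_pV2 ?posrE; lra.
Qed.

(** The absolute value of the Lagrange weight. The value 0 for N <= k makes it
    monotone in N over all of nat. *)
Definition node_weight (R : realType) (q : R) (k N : nat) : R :=
  if (k < N)%N then
    \prod_(j < N | j != k :> nat) `|1 - power_node q k / power_node q j|^-1
  else 0.

Lemma node_weight_ge0 (R : realType) (q : R) (k N : nat) : 0 <= node_weight q k N.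
Proof. by rewrite /node_weight; case: ifP => // _; exact: prodr_ge0. Qed.

Lemma node_weight_le (R : realType) (q : R) (k N : nat) : 2 < q ->
  node_weight q k N <= 2 * (2 / q) ^+ k.
Proof.
move=> q2; rewrite /node_weight; case: ifP => [kN|_]; last first.
  by rewrite mulr_ge0// exprn_ge0// divr_ge0//; lra.
rewrite -(prod_below _ kN) mulrC.
apply: le_trans (ler_wpM2l _ (square_weight_le2 R kN)); last first.
  by apply: prodr_ge0 => j _; case: ifP => // _; apply: divr_ge0; lra.
rewrite -big_split /=; apply: ler_prod => j jk; rewrite invr_ge0 normr_ge0 /=.
case: ifPn => [jk'|]; first exact: power_gap_inv_below.
rewrite -leqNgt leq_eqVlt eq_sym (negbTE jk) mul1r /= => kj.
exact: power_gap_inv_above.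
Qed.

(** A node added above k contributes a factor 1 / (1 - x) with 0 < x < 1. *)
Lemma node_weight_nondecreasing (R : realType) (q : R) (k : nat) : 2 < q ->
  nondecreasing_seq (node_weight q k).
Proof.
move=> q2; apply/nondecreasing_seqP => N.
rewrite {2}/node_weight ltnS leq_eqVlt; case: eqP => [-> /=|/eqP kN /=].
  by rewrite /node_weight ltnn prodr_ge0.
case: ifPn => [k_lt_N|]; last by rewrite /node_weight => /negbTE ->.
rewrite (big_ord_recr_neq (fun j => `|1 - _ / power_node q j|^-1)) eq_sym kN.
rewrite /node_weight k_lt_N ler_peMr ?prodr_ge0//.
have q0 : 0 < q by lra.
have uk := ltr_power_node q0 k_lt_N.
have r1 : power_node q k / power_node q N < 1.
  by rewrite ltr_pdivrMr ?power_node_gt0// mul1r.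
have r0 : 0 < power_node q k / power_node q N.
  by rewrite divr_gt0 ?power_node_gt0.
rewrite gtr0_norm ?subr_gt0// invf_ge1 ?subr_gt0//; lra.
Qed.

(** Exactly the k nodes below the k-th one give negative factors. *)
Lemma lagrange_weight_sign (R : realType) (q : R) (k N : nat) : 0 < q ->
  (k < N)%N ->
  lagrange_weight (power_node q) N k = (-1) ^+ k * node_weight q k N.
Proof.
move=> q0 kN; rewrite /node_weight kN -(prod_below (-1) kN) -big_split /=.
apply: eq_bigr => j jk; case: ifPn => [jk'|].
  rewrite mulN1r ltr0_norm ?invrN ?opprK// subr_lt0.
  by rewrite ltr_pdivlMr ?power_node_gt0// mul1r ltr_power_node.
rewrite -leqNgt leq_eqVlt eq_sym (negbTE jk) mul1r /= => kj.
rewrite gtr0_norm// subr_gt0 ltr_pdivrMr ?power_node_gt0// mul1r.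
exact: ltr_power_node.
Qed.

Lemma node_weight_balance (R : realType) (q : R) (b : bool) (m N : nat) :
  0 < q -> (0 < m < N)%N ->
  \sum_(k < N) (odd k == b)%:R * node_weight q k N * power_node q k ^+ m =
  \sum_(k < N) (odd k == ~~ b)%:R * node_weight q k N * power_node q k ^+ m.
Proof.
move=> q0 mN; apply/eqP; rewrite -subr_eq0 -sumrB; apply/eqP.
rewrite -[RHS](mulr0 ((-1) ^+ b)).
rewrite -[in RHS](lagrange_weight_moment (power_node_inj q0) _ mN); last first.
  by move=> k; rewrite gt_eqF// power_node_gt0.
rewrite mulr_sumr; apply: eq_bigr => k _.
rewrite lagrange_weight_sign// -(signr_odd _ k).
by case: (odd k); case: b => /=; ring.
Qed.

(** Limits of sums whose terms and range both depend on N: the terms of F are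
    nonnegative and those of G stay below their limits, so that a fixed finite
    part of the sum of f is a limit of quantities below the sum of g. *)
Lemma le_nneseries_of_partial (R : realType) (F G : nat -> nat -> R)
    (f g : nat -> R) (N0 : nat) :
  (forall k N, 0 <= F k N) -> (forall k, F k N @[N --> \oo] --> f k) ->
  (forall k, 0 <= f k) -> (forall k, 0 <= g k) -> (forall k N, G k N <= g k) ->
  (forall N, (N0 <= N)%N -> \sum_(k < N) F k N = \sum_(k < N) G k N) ->
  (\sum_(k <oo) (f k)%:E <= \sum_(k <oo) (g k)%:E)%E.
Proof.
move=> F0 Ff f0 g0 Gg FG.
apply: lime_le => [|]; first by apply: is_cvg_nneseries => k _ _; rewrite lee_fin.
apply: nearW => M.
have cvg_partial : (\sum_(0 <= k < M) (F k N)%:E)%E @[N --> \oo] -->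
    (\sum_(0 <= k < M) (f k)%:E)%E.
  apply: cvg_nnesum => k _; first by apply: nearW => N; rewrite lee_fin.
  by apply: cvg_EFin; [exact: nearW|exact: Ff].
apply: cvge_to_le cvg_partial _; near=> N.
have MN : (M <= N)%N by near: N; exact: nbhs_infty_ge.
have N0N : (N0 <= N)%N by near: N; exact: nbhs_infty_ge.
apply: (@le_trans _ _ (\sum_(0 <= k < N) (F k N)%:E)%E).
  by apply: lee_sum_nneg_natr => // k _ _; rewrite lee_fin.
apply: (@le_trans _ _ (\sum_(0 <= k < N) (g k)%:E)%E).
  rewrite !sumEFin lee_fin !big_mkord FG//.
  by apply: ler_sum => k _; exact: Gg.
by apply: nneseries_lim_ge => k _ _; rewrite lee_fin.
Unshelve. all: by end_near. Qed.

(** The finite alternating identities pass to the limit. The parity b selects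
    the nodes with odd or even index. For m = 0 the two sums differ by 1, the
    value at 0 of the constant 1. *)
Lemma exists_balanced_weights (R : realType) (q : R) : 2 < q ->
  exists w : nat -> R, [/\ 0 < w 0%N, forall k, 0 <= w k,
    forall k, w k <= 2 * (2 / q) ^+ k &
    forall (b : bool) m, (0 < m)%N ->
      (\sum_(k <oo) ((odd k == b)%:R * w k * power_node q k ^+ m)%:E =
       \sum_(k <oo) ((odd k == ~~ b)%:R * w k * power_node q k ^+ m)%:E)%E].
Proof.
move=> q2; pose w k := limn (node_weight q k).
have cw k : node_weight q k @ \oo --> w k.
  apply: (@nondecreasing_is_cvgn R); first exact: node_weight_nondecreasing.
  by exists (2 * (2 / q) ^+ k) => _ [N _ <-]; exact: node_weight_le.
have node_w k N : node_weight q k N <= w k.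
  apply: nondecreasing_cvgn_le; first exact: node_weight_nondecreasing.
  exact: cw.
have w0 k : 0 <= w k := le_trans (node_weight_ge0 q k 0) (node_w k 0).
exists w; split => //.
- apply: lt_le_trans (node_w 0 1).
  by rewrite /node_weight /= big_pred0// => j; rewrite ord1.
- move=> k; apply: limr_le; first exact: cw.
  by apply: nearW => N; exact: node_weight_le.
suff le_parts b m : (0 < m)%N ->
    (\sum_(k <oo) ((odd k == b)%:R * w k * power_node q k ^+ m)%:E <=
     \sum_(k <oo) ((odd k == ~~ b)%:R * w k * power_node q k ^+ m)%:E)%E.
  move=> b m m0; apply/eqP; rewrite eq_le le_parts//=.
  by have := le_parts (~~ b) m m0; rewrite negbK.
move=> m0; have u0 k : 0 <= power_node q k ^+ m.
  by rewrite exprn_ge0// ltW// power_node_gt0.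
apply: (@le_nneseries_of_partial R
  (fun k N => (odd k == b)%:R * node_weight q k N * power_node q k ^+ m)
  (fun k N => (odd k == ~~ b)%:R * node_weight q k N * power_node q k ^+ m)
  _ _ m.+1).
- by move=> k N; rewrite !mulr_ge0// node_weight_ge0.
- move=> k; apply: cvgM; last exact: cvg_cst.
  by apply: cvgM; [exact: cvg_cst|exact: cw].
- by move=> k; rewrite !mulr_ge0.
- by move=> k; rewrite !mulr_ge0.
- by move=> k N; rewrite ler_wpM2r// ler_wpM2l.
- by move=> N mN; apply: node_weight_balance; [lra|rewrite m0].
Qed.

(** * Stretched exponentials against geometric decay *)

(** Split at the point where C x^(tau - 1) equals delta. *)
Lemma powR_sublinear (R : realType) (C delta tau : R) :
  0 < C -> 0 < delta -> 0 < tau < 1 ->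
  exists D, forall x, 0 < x -> C * x `^ tau <= delta * x + D.
Proof.
move=> C0 delta0 /andP[tau0 tau1].
pose y := (C / delta) `^ (1 - tau)^-1; exists (C * y `^ tau) => x x0.
have [yx|xy] := leP y x.
  have Cx : C / delta <= x `^ (1 - tau).
    have -> : C / delta = y `^ (1 - tau).
      by rewrite -powRrM mulVf ?powRr1 ?divr_ge0 ?ltW// gt_eqF// subr_gt0.
    by rewrite ge0_ler_powR ?nnegrE ?powR_ge0 ?(ltW x0)//; lra.
  have -> : delta * x = delta * x `^ (1 - tau) * x `^ tau.
    rewrite -mulrA -powRD ?subrK ?powRr1 ?ltW//.
    by rewrite oner_eq0.
  rewrite ler_wpDr ?mulr_ge0 ?powR_ge0 ?(ltW C0)// ler_wpM2r ?powR_ge0//.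
  by move: Cx; rewrite ler_pdivrMr// mulrC.
rewrite ler_wpDl ?mulr_ge0 ?(ltW x0) ?(ltW delta0)// ler_wpM2l ?(ltW C0)//.
by rewrite ge0_ler_powR ?nnegrE ?powR_ge0 ?(ltW x0) ?ltW.
Qed.

(** From ln y < y applied to y = x^tau. *)
Lemma powR_le_expR (R : realType) (g tau x : R) : 0 <= g -> 0 < tau -> 1 <= x ->
  x `^ g <= expR (g / tau * x `^ tau).
Proof.
move=> g0 tau0 x1; have x0 : 0 < x by lra.
rewrite {1}/powR gt_eqF// ler_expR -mulrA ler_wpM2l//.
rewrite -(ler_pM2l tau0) mulrA divff ?gt_eqF// mul1r -ln_powR.
by apply/ltW/ln_sublinear; rewrite powR_gt0.
Qed.

(** A geometric factor beats a stretched exponential of order below one. *)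
Lemma geometric_stretched_expR_bounded (R : realType) (r q D tau : R) :
  0 < r < 1 -> 0 < q -> 0 <= D -> 0 < tau < 1 ->
  exists2 K, 0 < K & forall k : nat,
    r ^+ k * (k.+1%:R `^ q * expR (D * k.+1%:R `^ tau)) <= K.
Proof.
move=> /andP[r0 r1] q0 D0 tau01; have /andP[tau0 tau1] := tau01.
have rho0 : 0 < - ln r by rewrite oppr_gt0 ln_lt0// r0.
have C0 : 0 < q / tau + D by rewrite ltr_pwDl// divr_gt0.
have [E le_lin] := powR_sublinear C0 rho0 tau01.
exists (expR (E - ln r)) => [|k]; first exact: expR_gt0.
have -> : r ^+ k = expR (- (- ln r * k%:R)).
  by rewrite mulNr opprK expRM_natr lnK ?posrE.
apply: (@le_trans _ _ (expR (- (- ln r * k%:R)) *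
    (expR (q / tau * k.+1%:R `^ tau) * expR (D * k.+1%:R `^ tau)))).
  rewrite ler_wpM2l ?expR_ge0// ler_wpM2r ?expR_ge0//.
  by rewrite powR_le_expR// ?(ltW q0)// ler1n.
rewrite -!expRD ler_expR.
have := le_lin k.+1%:R (ltr0Sn _ _); rewrite -[k.+1]addn1 natrD.
by set x := _ `^ tau; nra.
Qed.

(** * Exchanging equal-moment parts of a law *)

(** The difference of m and n is a signed measure, nonnegative since n lies
    below m. *)
Lemma exists_measure_difference d (T : measurableType d) (R : realType)
    (m : {finite_measure set T -> \bar R}) (n : {measure set T -> \bar R}) :
  (forall A, measurable A -> (n A <= m A)%E) ->
  exists k : {measure set T -> \bar R},
    forall A, measurable A -> m A = measure_add k n A.
Proof.
move=> n_le_m.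
have nT : (n setT < +oo)%E.
  by rewrite (le_lt_trans (n_le_m _ measurableT))// ltey_eq fin_num_measure.
pose c := cadd (charge_of_finite_measure m)
  (copp (charge_of_finite_measure (mfrestr measurableT nT))).
have cE A : c A = (m A - n A)%E.
  by rewrite /c /cadd /= /copp /= /charge_of_finite_measure /mfrestr /mrestr setIT.
(* Off the measurable sets the difference may be negative; there it is
   replaced by zero. *)
have c_ge0 A : (0 <= crestr0 c measurableT A)%E.
  rewrite /crestr0; case: ifPn => // /set_mem mA.
  by rewrite /crestr setIT cE sube_ge0 ?n_le_m ?fin_num_measure ?orbT.
exists (measure_of_charge (crestr0 c measurableT) c_ge0) => A mA.
have -> : measure_add (measure_of_charge _ c_ge0) n A = (m A - n A + n A)%E.
  rewrite measure_addE /= /measure_of_charge /crestr0 mem_set// /crestr setIT.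
  by congr (_ + _)%E; exact: cE.
rewrite subeK// ge0_fin_numE// (le_lt_trans (n_le_m _ mA))//.
by rewrite ltey_eq fin_num_measure.
Qed.

Lemma integrable_measure_addP d (T : measurableType d) (R : realType)
    (m1 m2 : {measure set T -> \bar R}) (f : T -> \bar R) :
  (measure_add m1 m2).-integrable setT f <->
  m1.-integrable setT f /\ m2.-integrable setT f.
Proof.
split=> [/integrableP[mf]|[/integrableP[mf if1] /integrableP[_ if2]]].
  rewrite ge0_integral_measure_add//; last exact: measurableT_comp.
  move=> sum_fin; split; apply/integrableP; split => //.
  - by apply: le_lt_trans sum_fin; rewrite leeDl// integral_ge0.
  - by apply: le_lt_trans sum_fin; rewrite leeDr// integral_ge0.
apply/integrableP; split => //.
rewrite ge0_integral_measure_add//; last exact: measurableT_comp.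
exact: lte_add_pinfty.
Qed.

Lemma eq_measure_integrable d (T : measurableType d) (R : realType)
    (m1 m2 : {measure set T -> \bar R}) (f : T -> \bar R) :
  (forall A, measurable A -> m1 A = m2 A) ->
  m1.-integrable setT f -> m2.-integrable setT f.
Proof.
move=> m12 /integrableP[mf if1]; apply/integrableP; split => //.
rewrite (eq_measure_integral m1)// => A mA _; exact/esym/m12.
Qed.

Lemma le_measure_integrable d (T : measurableType d) (R : realType)
    (m : {finite_measure set T -> \bar R}) (n : {measure set T -> \bar R})
    (f : T -> \bar R) :
  (forall A, measurable A -> (n A <= m A)%E) ->
  m.-integrable setT f -> n.-integrable setT f.
Proof.
move=> n_le_m int_m; have [k kE] := exists_measure_difference n_le_m.
by have /integrable_measure_addP[] := eq_measure_integrable kE int_m.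
Qed.

Lemma integrable_distribution_expn d (T : measurableType d) (R : realType)
    (P : probability T R) (X : {RV P >-> R}) (k : nat) :
  finite_moments P X ->
  (distribution P X).-integrable setT (fun x : R => (x ^+ k)%:E).
Proof.
move=> fmX; have mX : measurable_fun setT (fun x : R => (x ^+ k)%:E).
  by apply/measurable_EFinP; exact: measurable_funX.
apply/integrableP; split => //.
rewrite ge0_integral_distribution//; last exact: measurableT_comp.
by have /integrableP[] := fmX k.
Qed.

(** The competing law is obtained from the law of X by removing Mn and adding
    Mp; the case k = 0 of the moment equality keeps the total mass equal
    to 1. *)
Lemma M_indet_of_equal_moments d (T : measurableType d) (R : realType)
    (P : probability T R) (X : {RV P >-> R})
    (Mp Mn : {measure set R -> \bar R}) :
  finite_moments P X ->
  (forall A, measurable A -> (Mn A <= distribution P X A)%E) ->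
  (forall k, Mp.-integrable setT (fun x => (x ^+ k)%:E)) ->
  (forall k, \int[Mp]_x (x ^+ k)%:E = \int[Mn]_x (x ^+ k)%:E)%E ->
  (exists2 A, measurable A & Mp A <> Mn A) ->
  M_indet P X.
Proof.
move=> fmX Mn_le Mp_int eq_mom [A0 mA0 MpMn]; split => // -[_ det].
have [D DE] := exists_measure_difference Mn_le.
have mX k : measurable_fun setT (fun x : R => (x ^+ k)%:E).
  by apply/measurable_EFinP; exact: measurable_funX.
have /all_and2[D_int Mn_int] k : D.-integrable setT (fun x : R => (x ^+ k)%:E) /\
    Mn.-integrable setT (fun x : R => (x ^+ k)%:E).
  apply/integrable_measure_addP/(eq_measure_integrable DE).
  exact: integrable_distribution_expn.
have Mp_MnT : Mp setT = Mn setT.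
  have mass (m : {measure set R -> \bar R}) :
      (\int[m]_x (x ^+ 0)%:E = m setT)%E.
    rewrite (eq_integral (cst 1%E)); last by move=> x _; rewrite expr0.
    by rewrite integral_cst// mul1e.
  by rewrite -!mass.
pose nu := measure_add D Mp.
have nuT : nu setT = 1%E.
  by rewrite /nu measure_addE Mp_MnT -measure_addE -DE//; exact: probability_setT.
have [nuP nuPE] : exists nuP : probability R R, forall A, nuP A = nu A.
  by exists (HB.pack_for (probability R R) (nu : set R -> \bar R) (Measure.on nu)
    (Measure_isProbability.Build _ _ _ (nu : set R -> \bar R) nuT)).
have nu_int k : nuP.-integrable setT (fun x : R => (x ^+ k)%:E).
  apply: (eq_measure_integrable (fun A _ => esym (nuPE A))).
  by apply/integrable_measure_addP; split.
have : nuP A0 = pushforward P X A0.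
  apply: (det nuP nu_int _ _ mA0) => k _; rewrite /moment unlock.
  rewrite (eq_measure_integral nu) => [|A _ _]; last exact: nuPE.
  rewrite integral_measure_add// eq_mom -integral_measure_add//.
  rewrite (eq_measure_integral (distribution P X)).
    by rewrite integral_distribution; [|exact: mX|exact: fmX].
  by move=> A mA _; exact/esym/DE.
rewrite nuPE /nu -[RHS]/(distribution P X A0) DE// !measure_addE.
have DA0 : D A0 \is a fin_num.
  have : distribution P X A0 \is a fin_num by exact: fin_num_measure.
  by rewrite DE// measure_addE fin_numD => /andP[].
move=> /(congr1 (fun z => z - D A0)%E) /=.
by rewrite !(addeC (D A0)) !addeK// => /MpMn.
Qed.

(** * Mixtures of dilates of a symmetric measure *)

Section mixture.
Context (R : realType) (mu : {measure set R -> \bar R}).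
Local Open Scope ereal_scope.

Definition dilate (t : R) (A : set R) : \bar R := mu ( *%R t @^-1` A).

Let measurable_mul (t : R) : measurable_fun setT ( *%R t).
Proof. exact: mulrl_measurable. Qed.

Let dilate0 t : dilate t set0 = 0.
Proof. by rewrite /dilate preimage_set0 measure0. Qed.

Let dilate_ge0 t A : 0 <= dilate t A.
Proof. exact: measure_ge0. Qed.

Let dilate_sigma_additive t : semi_sigma_additive (dilate t).
Proof.
exact: (@measure_semi_sigma_additive _ _ _ (pushforward mu ( *%R t))).
Qed.

HB.instance Definition _ t := isMeasure.Build _ _ _ (dilate t)
  (dilate0 t) (dilate_ge0 t) (@dilate_sigma_additive t).

Lemma ge0_integral_dilate t (f : R -> \bar R) : measurable_fun setT f ->
  (forall x, 0 <= f x) -> \int[dilate t]_x f x = \int[mu]_x f (t * x)%R.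
Proof. by move=> mf f0; rewrite [LHS]ge0_integral_pushforward. Qed.

Variables (v t : nat -> R) (v_ge0 : forall k, (0 <= v k)%R).

Definition mixture : set R -> \bar R :=
  mseries (fun k => mscale (NngNum (v_ge0 k)) (dilate (t k))) 0.

HB.instance Definition _ := Measure.on mixture.

Lemma mixtureE A : mixture A = \sum_(k <oo) ((v k)%:E * dilate (t k) A).
Proof. by []. Qed.

(** Even powers are written as squares of powers to make their sign manifest;
    both sides may be infinite. *)
Lemma mixture_even_moment (m : nat) :
  \int[mixture]_x ((x ^+ m) ^+ 2)%:E =
  \sum_(k <oo) ((v k * (t k ^+ m) ^+ 2)%:E * \int[mu]_x ((x ^+ m) ^+ 2)%:E).
Proof.
have mf : measurable_fun setT (fun x : R => ((x ^+ m) ^+ 2)%:E).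
  by apply/measurable_EFinP/measurable_funX; exact: measurable_funX.
have f0 (x : R) : 0 <= ((x ^+ m) ^+ 2)%:E by rewrite lee_fin sqr_ge0.
rewrite [LHS]ge0_integral_measure_series//; apply: eq_eseriesr => k _.
rewrite ge0_integral_mscale//= ge0_integral_dilate//.
under eq_integral do rewrite !exprMn EFinM.
by rewrite ge0_integralZl// ?lee_fin ?sqr_ge0// muleA.
Qed.

Hypothesis mu_sym : forall A : set R, measurable A -> mu (-%R @^-1` A) = mu A.

Lemma mixture_sym (A : set R) : measurable A -> mixture (-%R @^-1` A) = mixture A.
Proof.
move=> mA; rewrite !mixtureE; apply: eq_eseriesr => k _; congr (_ * _).
have mtA : measurable ( *%R (t k) @^-1` A).
  by rewrite -[X in measurable X]setTI; exact: measurable_mul.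
rewrite /dilate -[RHS](mu_sym mtA).
by congr (mu _); apply/seteqP; split => x /=; rewrite mulrN.
Qed.

End mixture.

(** The reflection preserves the measure and changes the sign of the
    integrand. *)
Lemma symmetric_odd_moment (R : realType) (mu : {measure set R -> \bar R}) m :
  (forall A : set R, measurable A -> mu (-%R @^-1` A) = mu A) -> odd m ->
  mu.-integrable setT (fun x => (x ^+ m)%:E) ->
  (\int[mu]_x (x ^+ m)%:E = 0)%E.
Proof.
move=> mu_sym m_odd int_m.
have m_opp : measurable_fun setT (-%R : R -> R) by exact: oppr_measurable.
have integral_opp : (\int[mu]_x (x ^+ m)%:E = - \int[mu]_x (x ^+ m)%:E)%E.
  have int_opp : mu.-integrable setT ((fun x : R => (x ^+ m)%:E) \o -%R).
    have -> : (fun x : R => (x ^+ m)%:E) \o -%R = (fun x => - (x ^+ m)%:E)%E.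
      by apply/funext => x /=; rewrite exprNn -signr_odd m_odd mulN1r.
    exact: integrableN.
  rewrite -[in LHS](@eq_measure_integral _ _ _ _ mu (pushforward mu -%R)).
    rewrite integral_pushforward//; last exact: measurable_int int_m.
    rewrite -integralN//; last first.
      exact: integrable_add_def.
    by apply: eq_integral => x _ /=; rewrite exprNn -signr_odd m_odd mulN1r.
  by move=> A mA _; exact: mu_sym.
have := integrable_fin_num measurableT int_m; move: integral_opp.
by case: (integral _ _ _) => //= r [] rr _; congr (_%:E); lra.
Qed.

(** * Indeterminacy from a stretched exponential minorant *)

Lemma geometric_eseries (R : realType) (r : R) : 0 < r < 1 ->
  (\sum_(k <oo) ((1 - r) * r ^+ k)%:E = 1)%E.
Proof.
move=> /andP[r0 r1]; have r_lt1 : `|r| < 1 by rewrite gtr0_norm.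
apply: cvg_lim => //.
have -> : (fun n => \sum_(0 <= k < n) ((1 - r) * r ^+ k)%:E)%E =
    EFin \o series (geometric (1 - r) r).
  by apply/funext => n; rewrite /= sumEFin.
apply: cvg_EFin; first exact: nearW.
have := @cvg_geometric_series R (1 - r) r r_lt1.
by rewrite divff// subr_eq0 gt_eqF.
Qed.

Lemma integrable_expn_of_even (R : realType) (mu : {measure set R -> \bar R}) :
  (forall m, (\int[mu]_x ((x ^+ m) ^+ 2)%:E < +oo)%E) ->
  forall k, mu.-integrable setT (fun x => (x ^+ k)%:E).
Proof.
move=> even_fin k.
have mX m : measurable_fun setT (fun x : R => (x ^+ m)%:E).
  by apply/measurable_EFinP; exact: measurable_funX.
have even_int m : mu.-integrable setT (fun x => ((x ^+ m) ^+ 2)%:E).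
  apply/integrableP; split.
    by apply/measurable_EFinP/measurable_funX; exact: measurable_funX.
  under eq_integral do rewrite gee0_abs ?lee_fin ?sqr_ge0//.
  exact: even_fin.
apply: (@le_integrable _ _ _ mu _ _ _
  (fun x => ((x ^+ 0) ^+ 2)%:E + ((x ^+ k) ^+ 2)%:E)%E) => //.
  move=> x _; rewrite -EFinD !abse_EFin lee_fin expr0 expr1n.
  rewrite [leRHS]ger0_norm; last by rewrite addr_ge0// sqr_ge0.
  rewrite -[(x ^+ k) ^+ 2]real_normK ?num_real//.
  by have := normr_ge0 (x ^+ k); nra.
exact: integrableD.
Qed.

(** The two mixtures over the even and the odd nodes are exchanged. The mass
    condition on the unit interval leaves the node of index zero as the only
    one that charges the interval ]0, t_1[, so the mixtures are different. *)
Lemma M_indet_of_dilate_minorant d (T : measurableType d) (R : realType)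
    (P : probability T R) (X : {RV P >-> R}) (mu : {measure set R -> \bar R})
    (L c C beta : R) :
  finite_moments P X ->
  (forall A : set R, measurable A -> mu (-%R @^-1` A) = mu A) ->
  (forall m, (\int[mu]_x ((x ^+ m) ^+ 2)%:E < +oo)%E) ->
  mu `]0, 1[%classic = 0%E -> (0%E < mu `]0%R, 2%R[%classic)%E ->
  0 < L -> 0 < c -> 0 <= C -> 0 < beta < 1 ->
  (forall t, L <= t -> forall A, measurable A ->
    ((c * expR (- (C * t `^ beta)))%:E * dilate mu t A <= distribution P X A)%E) ->
  M_indet P X.
Proof.
move=> fmX mu_sym mu_even mu01 mu02 L0 c0 C0 /andP[beta0 beta1] minorant.
(* The midpoint between 2 and 2 / beta: the weights decay geometrically because
   q > 2, and t_k^beta grows like a power of k below the first because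
   q beta / 2 < 1. *)
pose q := 1 + beta^-1.
have ibeta1 : 1 < beta^-1 by rewrite invf_gt1.
have q2 : 2 < q by rewrite /q; lra.
have q0 : 0 < q by lra.
pose tau := q / 2 * beta.
have tau01 : 0 < tau < 1.
  have -> : tau = (beta + 1) / 2.
    by rewrite /tau /q; field; rewrite gt_eqF.
  by apply/andP; split; lra.
(* One factor r^k of the weight (2 / q)^k absorbs the growth of u_k and of
   exp (C t_k^beta); the other one makes the minorants summable. *)
pose r := Num.sqrt (2 / q).
have r2 : r ^+ 2 = 2 / q by rewrite sqr_sqrtr// divr_ge0//; lra.
have r01 : 0 < r < 1.
  have iq : 2 / q < 1 by rewrite ltr_pdivrMr//; lra.
  rewrite sqrtr_gt0 divr_gt0//=.
  by rewrite -sqrtr1 ltr_sqrt.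
have /andP[r0 r1] := r01.
have D0 : 0 <= C * L `^ beta by rewrite mulr_ge0// powR_ge0.
have [K K0 leK] := geometric_stretched_expR_bounded r01 q0 D0 tau01.
have [w [w_gt0 w_ge0 w_le w_bal]] := exists_balanced_weights q2.
pose eta := c * (1 - r) / (2 * K).
have eta0 : 0 < eta by rewrite divr_gt0 ?mulr_gt0//; lra.
pose t k := L * power_node (q / 2) k.
have t_ge k : L <= t k.
  rewrite /t -[leLHS]mulr1 ler_pM2l// -[leLHS](powRr0 k.+1%:R).
  by rewrite ler_powR ?ler1n//; lra.
have t_sqr k : t k ^+ 2 = L ^+ 2 * power_node q k.
  rewrite exprMn; congr (_ * _).
  by rewrite -powR_mulrn ?powR_ge0// -powRrM divfK.
have t_beta k : t k `^ beta = L `^ beta * k.+1%:R `^ tau.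
  by rewrite /t powRM ?powR_ge0 ?(ltW L0)// /power_node -powRrM.
pose v b k := eta * ((odd k == b)%:R * w k * power_node q k).
have v_ge0 b k : 0 <= v b k.
  apply: mulr_ge0; first exact: ltW.
  by rewrite !mulr_ge0 ?ler0n ?w_ge0 ?power_node_ge0.
have v_le b k : v b k <= (1 - r) * r ^+ k * (c * expR (- (C * t k `^ beta))).
  rewrite t_beta; set E := C * _.
  apply: (@le_trans _ _ (eta * ((2 * (2 / q) ^+ k) * power_node q k))).
    rewrite ler_pM2l// ler_wpM2r ?power_node_ge0//.
    apply: le_trans (w_le k); rewrite -[leRHS]mul1r ler_wpM2r//.
    by case: (_ == _).
  have := leK k; rewrite -/(power_node q k) -[C * _ * _]mulrA -/E => leKk.
  have -> : (2 / q) ^+ k = r ^+ k * r ^+ k by rewrite -r2 expr2 exprMn.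
  have EE : expR E * expR (- E) = 1 by rewrite expRxMexpNx_1.
  rewrite /eta; set u := power_node q k in leKk *.
  have -> : c * (1 - r) / (2 * K) * (2 * (r ^+ k * r ^+ k) * u) =
    (c * (1 - r) * r ^+ k * expR (- E)) * (r ^+ k * (u * expR E) / K).
    by rewrite -[LHS]mulr1 -EE; field; rewrite !gt_eqF ?expR_gt0.
  rewrite [leRHS](_ : _ = (c * (1 - r) * r ^+ k * expR (- E)) * 1); last by ring.
  rewrite ler_wpM2l//.
    by rewrite !mulr_ge0 ?expR_ge0 ?exprn_ge0 ?(ltW c0) ?(ltW r0)//; lra.
  by rewrite ler_pdivrMr// mul1r.
pose M b : {measure set R -> \bar R} := mixture mu t (v_ge0 b).
have M_le b A : measurable A -> (M b A <= distribution P X A)%E.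
  move=> mA; rewrite [leLHS]mixtureE.
  apply: (@le_trans _ _
    (\sum_(k <oo) ((1 - r) * r ^+ k)%:E * distribution P X A)%E).
    apply: lee_nneseries => k _; first by rewrite mule_ge0 ?lee_fin.
    apply: (@le_trans _ _ (((1 - r) * r ^+ k)%:E *
       ((c * expR (- (C * t k `^ beta)))%:E * dilate mu (t k) A))%E).
      by rewrite muleA -EFinM lee_wpmul2r ?lee_fin.
    rewrite lee_wpmul2l ?lee_fin ?mulr_ge0 ?exprn_ge0 ?(ltW r0)//; last first.
      exact: minorant.
    lra.
  have PA : distribution P X A \is a fin_num by exact: fin_num_measure.
  under eq_eseriesr do rewrite -(fineK PA) muleC.
  rewrite nneseriesZl; last first.
    by move=> k _; rewrite lee_fin mulr_ge0 ?exprn_ge0 ?(ltW r0)//; lra.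
  by rewrite geometric_eseries// mule1 fineK.
have M_even b m : (\int[M b]_x ((x ^+ m) ^+ 2)%:E < +oo)%E.
  have : (M b).-integrable setT (fun x => ((x ^+ m) ^+ 2)%:E).
    apply: le_measure_integrable (M_le b) _.
    under eq_fun do rewrite -exprM.
    exact: integrable_distribution_expn.
  move=> /(integrable_fin_num measurableT).
  by rewrite ge0_fin_numE// integral_ge0// => x _; rewrite lee_fin sqr_ge0.
have M_int b := integrable_expn_of_even (M_even b).
have M_even_eq m : (\int[M false]_x ((x ^+ m) ^+ 2)%:E =
                    \int[M true]_x ((x ^+ m) ^+ 2)%:E)%E.
  have K_fin : (\int[mu]_x ((x ^+ m) ^+ 2)%:E)%E \is a fin_num.
    by rewrite ge0_fin_numE ?integral_ge0// => x _; rewrite lee_fin sqr_ge0.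
  pose K' := fine (\int[mu]_x ((x ^+ m) ^+ 2)%:E).
  have K'0 : 0 <= K'.
    by rewrite fine_ge0// integral_ge0// => x _; rewrite lee_fin sqr_ge0.
  have ME b : (\int[M b]_x ((x ^+ m) ^+ 2)%:E = (eta * (L ^+ m) ^+ 2 * K')%:E *
      \sum_(k <oo) ((odd k == b)%:R * w k * power_node q k ^+ m.+1)%:E)%E.
    rewrite [LHS]mixture_even_moment -nneseriesZl => [|k _]; last first.
      by rewrite lee_fin !mulr_ge0 ?exprn_ge0 ?w_ge0 ?power_node_ge0 ?ler0n.
    apply: eq_eseriesr => k _; rewrite -(fineK K_fin) -/K' -!EFinM.
    rewrite -exprM mulnC exprM t_sqr exprMn [(L ^+ 2) ^+ m]exprAC.
    rewrite [power_node q k ^+ m.+1]exprSr /v.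
    by congr (_%:E); ring.
  by rewrite !ME (w_bal false m.+1).
have M_sym b (A : set R) : measurable A -> M b (-%R @^-1` A) = M b A.
  by move=> mA; exact: mixture_sym.
apply: (M_indet_of_equal_moments fmX (M_le true) (M_int false)).
  move=> k; have [k_odd|k_even] := boolP (odd k).
    rewrite (symmetric_odd_moment (M_sym false) k_odd (M_int false k)).
    by rewrite (symmetric_odd_moment (M_sym true) k_odd (M_int true k)).
  have [m ->] : exists m, k = (m * 2)%N.
    by exists k./2; rewrite muln2 even_halfK.
  have expnE b : (\int[M b]_x (x ^+ (m * 2))%:E = \int[M b]_x ((x ^+ m) ^+ 2)%:E)%E.
    by apply: eq_integral => x _; rewrite exprM.
  by rewrite !expnE.
(* The largest interval from the origin on which only the node of index zero
   puts mass. *)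
have t01 : t 0%N < t 1%N.
  by rewrite ltr_pM2l// ltr_power_node//; lra.
exists `]0, t 1%N[%classic => //; apply/eqP; rewrite gt_eqF//.
have -> : M true `]0, t 1%N[%classic = 0%E.
  rewrite [LHS]mixtureE; apply: eseries0 => k _ _.
  have [->|k0] := eqVneq k 0%N; first by rewrite /v /= !mul0r mulr0 mul0e.
  have tk : t 1%N <= t k.
    rewrite ler_pM2l//; move: k0; rewrite -lt0n leq_eqVlt => /predU1P[<-//|k1].
    by apply/ltW/ltr_power_node => //; lra.
  rewrite [dilate _ _ _](_ : _ = 0%E) ?mule0//.
  apply: subset_measure0 mu01 => //.
  - by rewrite -[X in measurable X]setTI; exact: mulrl_measurable.
  - move=> x /=; rewrite !in_itv /= => /andP[tx0 tx1].
    have tk0 : 0 < t k by exact: lt_le_trans (t_ge k).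
    have x0 : 0 < x by rewrite -(pmulr_rgt0 _ tk0).
    rewrite x0 /= -(ltr_pM2l tk0) mulr1; exact: lt_le_trans tk.
have v00 : 0 < v false 0%N.
  by rewrite /v mulr_gt0// !mulr_gt0 ?power_node_gt0.
have dilate_gt0 : (0 < dilate mu (t 0%N) `]0%R, t 1%N[%classic)%E.
  apply: lt_le_trans mu02 _; apply: le_measure; rewrite ?inE//.
    by rewrite -[X in measurable X]setTI; exact: mulrl_measurable.
  move=> x /=; rewrite !in_itv /= => /andP[x0 x2].
  have t00 : 0 < t 0%N by exact: lt_le_trans (t_ge 0%N).
  rewrite mulr_gt0//= /t -mulrA ltr_pM2l//.
  rewrite /power_node powR1 mul1r (lt_le_trans x2)//.
  by rewrite -[leLHS]powRr1// ler_powR//; lra.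
apply: (@lt_le_trans _ _
  ((v false 0%N)%:E * dilate mu (t 0%N) `]0%R, t 1%N[%classic)%E).
  by rewrite mule_gt0.
rewrite [leRHS]mixtureE; apply: le_trans (nneseries_lim_ge 1%N _); last first.
  by move=> k _ _; rewrite mule_ge0 ?lee_fin.
by rewrite big_nat1.
Qed.

(** * Laws with a density *)

Section density_measure.
Context (R : realType) (f : R -> R).
Hypothesis (mf : measurable_fun setT f) (f_ge0 : forall x, 0 <= f x).
Local Open Scope ereal_scope.

(** The hypotheses are arguments so that the measure structure can be attached
    to this function. *)
Definition density_measure & measurable_fun setT f & (forall x, 0 <= f x)%R :=
  fun A : set R => \int[lebesgue_measure]_(x in A) (f x)%:E.

Local Notation nu := (density_measure mf f_ge0).

Let nu0 : nu set0 = 0. Proof. exact: integral_set0. Qed.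

Let nu_ge0 A : 0 <= nu A.
Proof. by apply: integral_ge0 => x _; rewrite lee_fin. Qed.

Let nu_sigma_additive : semi_sigma_additive nu.
Proof.
move=> /= F mF tF mUF; rewrite /density_measure; apply: cvg_toP.
  apply: ereal_nondecreasing_is_cvgn => m n mn.
  by apply: lee_sum_nneg_natr => // k _ _; exact: nu_ge0.
rewrite ge0_integral_bigcup//=.
- by apply: measurable_funTS; exact/measurable_EFinP.
- by move=> x _; rewrite lee_fin.
Qed.

HB.instance Definition _ := isMeasure.Build _ _ _ nu
  nu0 nu_ge0 nu_sigma_additive.

End density_measure.

(** The identity is known on the rays, hence on the half-open intervals, which
    generate the Borel sets. *)
Lemma distribution_density d (T : measurableType d) (R : realType)
    (P : probability T R) (X : {RV P >-> R}) (f : R -> R) :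
  has_density X f -> forall A, measurable A ->
  (distribution P X A = \int[lebesgue_measure]_(x in A) (f x)%:E)%E.
Proof.
move=> [mf f0 cdfE] A mA.
rewrite -[RHS]/(density_measure mf f0 A).
apply: (measure_unique (@ocitv R) (fun n => `]- n%:R, n%:R]%classic)) => //.
- move=> I J; exact: (@measurableI _ (ocitv_type R)).
- by move=> n; exact: is_ocitv.
- exact: bigcup_itvT.
- move=> _ [[a b] _ <-] /=.
  have [ab|ba] := leP a b; last first.
    by rewrite set_itv_ge ?measure0 ?bnd_simp -?leNgt// ltW.
  have split_b : `]-oo, b]%classic = `]-oo, a] `|` `]a, b] :> set R.
    by rewrite -itv_bndbnd_setU ?bnd_simp.
  have disj : `]-oo, a] `&` `]a, b] = set0 :> set R.
    apply/seteqP; split => x //= [] ; rewrite !in_itv /= => xa /andP[ax _].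
    by move: (lt_le_trans ax xa); rewrite ltxx.
  have add_nu : (density_measure mf f0 `]-oo, b]%classic =
    density_measure mf f0 `]-oo, a]%classic +
    density_measure mf f0 `]a, b]%classic)%E.
    by rewrite split_b measureU.
  have add_P : (distribution P X `]-oo, b]%classic =
    distribution P X `]-oo, a]%classic + distribution P X `]a, b]%classic)%E.
    by rewrite split_b measureU.
  have Na : density_measure mf f0 `]-oo, a]%classic =
      distribution P X `]-oo, a]%classic.
    exact: esym (cdfE a).
  have Nb : density_measure mf f0 `]-oo, b]%classic =
      distribution P X `]-oo, b]%classic.
    exact: esym (cdfE b).
  have Pa_fin : distribution P X `]-oo, a]%classic \is a fin_num.
    exact: fin_num_measure.
  move: add_nu; rewrite Na Nb add_P.
  move=> /(congr1 (fun z => z - distribution P X `]-oo, a]%classic)%E) /=.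
  by rewrite !(addeC (distribution P X `]-oo, a]%classic)) !addeK.
- by move=> n; rewrite ltey_eq fin_num_measure.
Qed.

Lemma density_lower_bound d (T : measurableType d) (R : realType)
    (P : probability T R) (X : {RV P >-> R}) (f : R -> R) (c : R) (B : set R) :
  has_density X f -> measurable B -> 0 <= c -> (forall x, B x -> c <= f x) ->
  (c%:E * lebesgue_measure B <= distribution P X B)%E.
Proof.
move=> Xf mB c0 cf; rewrite (distribution_density Xf)//.
have [mf f0 _] := Xf.
rewrite -[leLHS]integral_cst//; apply: ge0_le_integral => //=.
by apply/measurable_EFinP; exact: measurable_funTS.
Qed.

Lemma lebesgue_measure_scale (R : realType) (c : R) (A : set R) : 0 < c ->
  measurable A ->
  (lebesgue_measure A = c%:E * lebesgue_measure ( *%R c @^-1` A))%E.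
Proof.
move=> c0 mA.
have m_mul : measurable_fun setT ( *%R c : measurableTypeR R -> measurableTypeR R).
  exact: (@mulrl_measurable R setT c).
pose c' : {nonneg R} := NngNum (ltW c0).
rewrite (@lebesgue_measure_unique R (mscale c' (pushforward lebesgue_measure
  ( *%R c : measurableTypeR R -> measurableTypeR R))))//.
move=> _ [[a b] _ <-] /=; rewrite /mscale /pushforward /=.
rewrite [X in (_ * lebesgue_measure X)%E]
  (_ : _ = `](a / c), (b / c)]%classic); last first.
  apply/seteqP; split => x /=; rewrite !in_itv /=;
    by rewrite ltr_pdivrMr// ler_pdivlMr// ![x * c]mulrC.
rewrite !lebesgue_measure_itv /= !lte_fin ltr_pM2r ?invr_gt0//.
case: ifP => _; last by rewrite mule0.
by rewrite -!EFinD -EFinM; congr (_%:E); field; rewrite gt_eqF.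
Qed.

(** * Lebesgue measure on a shell *)

(** Symmetric, bounded, and away from the origin: these give a symmetric base
    measure with finite moments and no mass in the unit interval. *)
Definition shell (R : realType) : set R := [set x | 1 <= `|x| <= 2].

Lemma measurable_shell (R : realType) : measurable (@shell R).
Proof.
have -> : @shell R = (Num.norm : R -> R) @^-1` `[1, 2]%classic.
  by apply/seteqP; split => x; rewrite /shell /= in_itv.
rewrite -[X in measurable X]setTI; exact: normr_measurable.
Qed.

Section shell_measure.
Context (R : realType).
Local Open Scope ereal_scope.

Definition shell_measure (A : set R) : \bar R :=
  lebesgue_measure (A `&` @shell R).

Let shell_measure0 : shell_measure set0 = 0.
Proof. by rewrite /shell_measure set0I measure0. Qed.

Let shell_measure_ge0 A : 0 <= shell_measure A.
Proof. exact: measure_ge0. Qed.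

Let shell_measure_sigma_additive : semi_sigma_additive shell_measure.
Proof.
exact: (@measure_semi_sigma_additive _ _ _
  (mrestr lebesgue_measure (@measurable_shell R))).
Qed.

HB.instance Definition _ := isMeasure.Build _ _ _ shell_measure
  shell_measure0 shell_measure_ge0 shell_measure_sigma_additive.

Lemma shell_measure_sym (A : set R) : measurable A ->
  shell_measure (-%R @^-1` A) = shell_measure A.
Proof.
move=> mA; rewrite /shell_measure -[RHS]lebesgue_measureN; last first.
  by apply: measurableI => //; exact: measurable_shell.
congr (lebesgue_measure _); apply/seteqP; split => x /= [Ax];
  by rewrite /shell /= ?normrN // normrN.
Qed.

Lemma shell_measure_even_moment_fin m :
  \int[shell_measure]_x ((x ^+ m) ^+ 2)%:E < +oo.
Proof.
have mS := @measurable_shell R.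
have mf : measurable_fun setT (fun x : R => ((x ^+ m) ^+ 2)%:E).
  by apply/measurable_EFinP/measurable_funX; exact: measurable_funX.
have f0 (x : R) : 0 <= ((x ^+ m) ^+ 2)%:E by rewrite lee_fin sqr_ge0.
have shellC : shell_measure (~` @shell R) = 0.
  by rewrite /shell_measure setICl measure0.
rewrite (ge0_negligible_integral (N := ~` @shell R))//; last exact: measurableC.
rewrite setTD setCK.
apply: (@le_lt_trans _ _ (\int[shell_measure]_(x in @shell R) ((2 ^+ m) ^+ 2)%:E)).
  apply: ge0_le_integral => //.
  - exact: measurable_funTS.
  - move=> x /andP[_ x2]; rewrite lee_fin -real_normK ?num_real// normrX.
    by rewrite lerXn2r ?nnegrE ?exprn_ge0// lerXn2r ?nnegrE.
rewrite integral_cst// lte_mul_pinfty ?lee_fin ?sqr_ge0//.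
apply: (@le_lt_trans _ _ (lebesgue_measure (`[(-2)%R, 2%R]%classic : set R))).
  apply: le_measure; rewrite ?inE//; first exact: measurableI.
  by move=> x [_ /andP[_]]; rewrite /= in_itv /= ler_norml.
by rewrite lebesgue_measure_itv /=; case: ifP => _; rewrite ?ltry.
Qed.

Lemma shell_measure_unit : shell_measure `]0%R, 1%R[%classic = 0.
Proof.
rewrite /shell_measure (_ : _ `&` _ = set0) ?measure0//.
apply/seteqP; split => x //= [].
rewrite in_itv /= => /andP[x0 x1] /andP[+ _]; rewrite gtr0_norm//.
by rewrite leNgt x1.
Qed.

Lemma shell_measure_gt0 : 0 < shell_measure `]0%R, 2%R[%classic.
Proof.
apply: (@lt_le_trans _ _ (lebesgue_measure (`]1%R, 2%R[%classic : set R))).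
  by rewrite lebesgue_measure_itv /= lte_fin ltr1n lte_fin subr_gt0 ltr1n.
apply: le_measure; rewrite ?inE//.
  by apply: measurableI => //; exact: measurable_shell.
move=> x /=; rewrite !in_itv /shell /= => /andP[x1 x2].
have x0 : (0 < x)%R by exact: lt_trans x1.
by rewrite x0 x2 gtr0_norm// !ltW.
Qed.

End shell_measure.

(** The substitution x = (t / v) s turns the part of the event where
    t / v <= |x| <= 2 t / v into the shell; the Jacobian is t / v. *)
Lemma dilate_shell_minorant d (T : measurableType d) (R : realType)
    (P : probability T R) (X : {RV P >-> R}) (f : R -> R) (c t v : R) (A : set R) :
  has_density X f -> 0 <= c -> 0 < t -> 0 < v -> measurable A ->
  (forall x, t / v <= `|x| <= 2 * (t / v) -> c <= f x) ->
  ((c * (t / v))%:E * dilate (@shell_measure R) t A <=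
   distribution P X ( *%R v @^-1` A))%E.
Proof.
move=> Xf c0 t0 v0 mA cf.
have tv0 : 0 < t / v by rewrite divr_gt0.
have mvA : measurable ( *%R v @^-1` A : set R).
  by rewrite -[X in measurable X]setTI; exact: mulrl_measurable.
pose B : set R := ( *%R v @^-1` A) `&` ( *%R (t / v)^-1 @^-1` @shell R).
have mB : measurable B.
  apply: measurableI => //.
  rewrite -[X in measurable X]setTI; apply: mulrl_measurable => //.
  exact: measurable_shell.
apply: (@le_trans _ _ (distribution P X B)); last first.
  by apply: le_measure; rewrite ?inE//; exact: subIsetl.
apply: le_trans (density_lower_bound Xf mB c0 _); last first.
  move=> x [_]; rewrite /shell /= normrM gtr0_norm ?invr_gt0// => /andP[x1 x2].
  apply: cf; move: x1 x2; rewrite mulrC ler_pdivlMr// mul1r => ->.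
  by rewrite ler_pdivrMr.
rewrite (lebesgue_measure_scale tv0 mB) muleA -EFinM.
rewrite (_ : *%R (t / v) @^-1` B = ( *%R t @^-1` A) `&` @shell R)//.
by apply/seteqP; split => x; rewrite /B /= mulrA mulrCA divff ?gt_eqF// mulr1
  mulrA mulVf ?gt_eqF// mul1r.
Qed.

(** * One variable against the product of the others *)

Lemma exists_finite_pushforward d d' (T : measurableType d)
    (T' : measurableType d') (R : realType)
    (m : {finite_measure set T -> \bar R}) (g : T -> T') :
  measurable_fun setT g ->
  exists n : {finite_measure set T' -> \bar R}, forall B, n B = m (g @^-1` B).
Proof.
move=> mg.
have push_fin : (pushforward m g setT < +oo)%E.
  by rewrite /pushforward preimage_setT ltey_eq fin_num_measure.
unshelve eexists (mfrestr measurableT push_fin); first exact: mg.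
by move=> B; rewrite /= /mfrestr /mrestr setIT.
Qed.

Section independence_of_one.
Context d (T : measurableType d) (R : realType) (P : probability T R)
  (I : finType) (X : I -> {RV P >-> R}) (j : I).
Hypothesis X_indep : mutually_independent X.

(** These sets are stable under intersection and generate the events that
    depend only on the variables other than X j. *)
Definition other_cylinders : set (set T) :=
  [set S | exists2 A : I -> set R, (forall i, measurable (A i)) &
    S = \bigcap_(i in [set i | i != j]) X i @^-1` A i].

Let measurable_preimage i (A : set R) : measurable A -> measurable (X i @^-1` A).
Proof. by move=> mA; rewrite -[X in measurable X]setTI; exact: measurable_funP. Qed.

Let measurable_cylinder S : other_cylinders S -> measurable S.
Proof.
move=> [A mA ->]; apply: fin_bigcap_measurable; first exact: finite_finset.
by move=> i _; exact: measurable_preimage.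
Qed.

Let cylinder_split (A : I -> set R) (B : set R) :
  (\bigcap_(i in [set i | i != j]) X i @^-1` A i) `&` X j @^-1` B =
  \bigcap_i X i @^-1` (if i == j then B else A i).
Proof.
apply/seteqP; split => [w [Aw Bw] i _ /=|w Aw]; first by case: eqP => [->//|/eqP /Aw].
split=> [i ij|].
  by have := Aw i Logic.I; rewrite /= (negbTE ij).
by have := Aw j Logic.I; rewrite /= eqxx.
Qed.

Let cylinder_prob (A : I -> set R) (B : set R) :
  (forall i, measurable (A i)) -> measurable B ->
  (P ((\bigcap_(i in [set i | i != j]) X i @^-1` A i) `&` X j @^-1` B) =
   P (X j @^-1` B) * \prod_(i | i != j) P (X i @^-1` A i))%E.
Proof.
move=> mA mB; rewrite cylinder_split X_indep => [|i]; last by case: eqP.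
rewrite (bigD1 j)//= eqxx; congr (_ * _)%E.
by apply: eq_bigr => i /negbTE ->.
Qed.

Lemma other_cylinders_prob (A : I -> set R) : (forall i, measurable (A i)) ->
  (P (\bigcap_(i in [set i | i != j]) X i @^-1` A i) =
   \prod_(i | i != j) P (X i @^-1` A i))%E.
Proof.
move=> mA; have := cylinder_prob mA measurableT.
by rewrite preimage_setT setIT probability_setT mul1e.
Qed.

(** Two finite measures that agree on the cylinders agree on the sigma-algebra
    that they generate. *)
Lemma independent_of_others (S : set T) (B : set R) :
  <<s other_cylinders >> S -> measurable B ->
  (P (S `&` X j @^-1` B) = P S * P (X j @^-1` B))%E.
Proof.
move=> sS mB; have mXB := measurable_preimage j mB.
have pB : P (X j @^-1` B) \is a fin_num by exact: fin_num_measure.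
pose p : {nonneg R} := NngNum (fine_ge0 (measure_ge0 P (X j @^-1` B))).
rewrite muleC -(fineK pB).
apply: (g_sigma_algebra_measure_unique other_cylinders _ (fun=> setT) _ _
  (mrestr P mXB) (mscale p P)) sS.
- exact: measurable_cylinder.
- move=> _; exists (fun=> setT) => //.
  by apply/seteqP; split.
- by apply: bigcup_const.
- move=> _ _ [A mA ->] [A' mA' ->]; exists (fun i => A i `&` A' i).
    by move=> i; exact: measurableI.
  by rewrite -bigcapI; apply: eq_bigcapr.
- move=> _ [A mA ->]; rewrite /= /mrestr /mscale /=.
  by rewrite cylinder_prob// other_cylinders_prob// fineK.
- by move=> k; rewrite ltey_eq fin_num_measure.
Qed.

Lemma others_prod_measurable (A : I -> set R) (C : set R) :
  (forall i, measurable (A i)) -> measurable C ->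
  <<s other_cylinders >> ((fun w => \prod_(i | i != j) X i w) @^-1` C `&`
    \bigcap_(i in [set i | i != j]) X i @^-1` A i).
Proof.
move=> mA mC; pose T' := g_sigma_algebraType other_cylinders.
have mX i : i != j -> measurable_fun setT (X i : T' -> R).
  move=> ij _ B mB; rewrite setTI; apply: sub_sigma_algebra.
  exists (fun k => if k == i then B else setT); first by move=> k; case: eqP.
  apply/seteqP; split => [w Bw k _ /=|w /(_ i ij)]; last by rewrite /= eqxx.
  by case: eqP => [->|].
apply: (@measurableI _ T').
  have -> : (fun w => \prod_(i | i != j) X i w) =
      (fun w : T' => \prod_(i <- [seq i <- index_enum I | i != j]) X i w).
    by apply/funext => w; rewrite big_filter.
  rewrite -[X in measurable X]setTI; apply: measurable_prod => // i.
  by rewrite mem_filter => /andP[ij _]; exact: mX.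
apply: (@fin_bigcap_measurable _ T'); first exact: finite_finset.
move=> i ij; rewrite -[X in measurable X]setTI.
by apply: mX => //; exact: mA.
Qed.

(** On a box in the other coordinates, the product of the other variables and
    X j have a product law, so the probability is an integral of the
    probabilities of the sections. The bound h need only hold for the values
    C of that product which the box allows. *)
Lemma le_prob_box_prod (A : I -> set R) (S : set (R * R)) (h : \bar R)
    (C : set R) :
  (forall i, measurable (A i)) -> measurable S -> measurable C -> (0 <= h)%E ->
  (forall w, (forall i, i != j -> A i (X i w)) ->
    C (\prod_(i | i != j) X i w)%R) ->
  (forall v, C v -> (h <= distribution P (X j) (xsection S v))%E) ->
  (h * \prod_(i | i != j) P (X i @^-1` A i) <=
   P [set w | S ((\prod_(i | i != j) X i w)%R, X j w)])%E.
Proof.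
move=> mA mS mC h0 AC hC.
pose E := \bigcap_(i in [set i | i != j]) X i @^-1` A i.
have mE : measurable E by apply: measurable_cylinder; exists A.
pose V w := \prod_(i | i != j) X i w.
have mV : measurable_fun setT V.
  have -> : V = fun w => \prod_(i <- [seq i <- index_enum I | i != j]) X i w.
    by apply/funext => w; rewrite big_filter.
  by apply: measurable_prod => i _; exact: measurable_funP.
have mVX : measurable_fun setT (fun w => (V w, X j w)).
  by apply: measurable_fun_pair => //; exact: measurable_funP.
have mVC B : measurable B -> measurable (V @^-1` B).
  by move=> mB; rewrite -[X in measurable X]setTI; exact: mV.
have [mu1 mu1E] := exists_finite_pushforward (mrestr P mE) mV.
have [joint jointE] := exists_finite_pushforward (mrestr P mE) mVX.
have prodE : (mu1 \x distribution P (X j))%E S = joint S.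
  apply: product_measure_unique => // B D mB mD.
  apply: (etrans (jointE _)); apply/esym.
  apply: (etrans (congr1 (fun z => z * P (X j @^-1` D))%E (mu1E B))).
  rewrite /= /mrestr -independent_of_others//.
    by congr (P _); apply/seteqP; split => w /= [[? ?] ?].
  exact: others_prod_measurable.
apply: (@le_trans _ _ (joint S)); last first.
  rewrite jointE /= /mrestr; apply: le_measure; rewrite ?inE//.
  - apply: measurableI => //.
    by rewrite -[X in measurable X]setTI; exact: mVX.
  - by rewrite -[X in measurable X]setTI; exact: mVX.
rewrite -prodE /product_measure1.
apply: (@le_trans _ _ (\int[mu1]_(v in C) h)%E).
  have -> : (\int[mu1]_(v in C) h = h * P (V @^-1` C `&` E))%E.
    apply: (etrans (integral_cst mu1 mC h)).
    exact: (congr1 (fun z => h * z)%E (mu1E C)).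
  rewrite lee_wpmul2l// -other_cylinders_prob//.
  apply: le_measure; rewrite ?inE//; first by apply: measurableI => //; exact: mVC.
  by move=> w Ew; split => //; exact: AC.
have m_sec : measurable_fun setT (distribution P (X j) \o xsection S).
  exact: measurable_fun_xsection.
apply: (@le_trans _ _
  (\int[mu1]_(v in C) (distribution P (X j) \o xsection S) v)%E).
  by apply: ge0_le_integral => //; exact: measurable_funTS.
exact: ge0_subset_integral.
Qed.
End independence_of_one.

(** * Moments of products and tails of the factors *)

(** The product is at most the #|I|-th power of its largest factor, so that
    moments of the factors control those of the product. *)
Lemma prod_le_sum_expn (R : realFieldType) (I : finType) (a : I -> R) :
  (forall i, 0 <= a i) -> \prod_i a i <= 1 + \sum_i a i ^+ #|I|.
Proof.
move=> a0; have [i0 _|I0] := pickP I; last first.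
  by rewrite big_pred0// lerDl sumr_ge0// => i; rewrite exprn_ge0.
have [i _ max_i] := @arg_maxP _ _ I i0 xpredT a isT.
apply: (@le_trans _ _ (a i ^+ #|I|)).
  by rewrite -prodr_const; apply: ler_prod => k _; rewrite a0; exact: max_i.
rewrite ler_wpDl// (bigD1 i)//= lerDl sumr_ge0// => k _.
by rewrite exprn_ge0.
Qed.

Lemma measurable_fun_prod_RV d (T : measurableType d) (R : realType)
    (P : probability T R) (I : finType) (X : I -> {RV P >-> R}) :
  measurable_fun setT (fun w => \prod_i X i w).
Proof.
by apply: measurable_prod => i _; exact: measurable_funP.
Qed.

Lemma finite_moments_prod d (T : measurableType d) (R : realType)
    (P : probability T R) (I : finType) (X : I -> {RV P >-> R}) :
  (forall i, finite_moments P (X i)) ->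
  finite_moments P (fun w => \prod_i X i w).
Proof.
move=> fmX k.
apply: (@le_integrable _ _ _ P _ _ _ (fun w =>
  (1 + \sum_i `|X i w ^+ (k * #|I|)|)%:E)) => //.
- apply/measurable_EFinP; apply: measurable_funX.
  exact: measurable_fun_prod_RV.
- move=> w _; rewrite -prodrXl !abse_EFin lee_fin normr_prod.
  rewrite [leRHS]ger0_norm; last by rewrite addr_ge0// sumr_ge0.
  apply: le_trans (prod_le_sum_expn _) _ => //.
  by rewrite lerD2l; apply: ler_sum => i _; rewrite -normrX -exprM.
- rewrite (_ : (fun w => _) = (fun w =>
      1%E + \sum_(i <- index_enum I) `|(X i w ^+ (k * #|I|))%:E|)%E); last first.
    by apply/funext => w; rewrite EFinD -sumEFin.
  apply: integrableD => //; first exact: finite_measure_integrable_cst.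
  apply: integrable_sum => // i _.
  exact/integrable_abse/fmX.
Qed.

Lemma powR_sum (R : realType) (I : finType) (p : I -> R) (t : R) : 0 < t ->
  t `^ (\sum_i p i) = \prod_i t `^ p i.
Proof.
move=> t0; apply: (big_rec2 (fun x y => t `^ x = y)); first by rewrite powRr0.
by move=> i x y _ <-; rewrite powRD// (gt_eqF t0) implybT.
Qed.

Section tails.
Context d (T : measurableType d) (R : realType) (P : probability T R)
  (X : {RV P >-> R}) (f : R -> R) (x0 A : R).
Hypothesis (Xf : has_density X f) (x0_gt0 : 0 < x0) (A_gt0 : 0 < A)
  (hazard_ge : forall x, x0 <= x -> A / x <= f x / fine (ccdf X x)).

Let tail_ge0 x : 0 <= fine (ccdf X x).
Proof. exact/fine_ge0/measure_ge0. Qed.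

(** The tail is nonincreasing, so the hazard rate bound at x also compares the
    density at x with the tail at any later point y. *)
Lemma density_ge_tail x y : x0 <= x <= y -> A / y * fine (ccdf X y) <= f x.
Proof.
move=> /andP[x0x xy]; have x_gt0 : 0 < x by exact: lt_le_trans x0x.
have [_ f0 _] := Xf.
apply: (@le_trans _ _ (A / x * fine (ccdf X x))).
  apply: ler_pM => //.
    by rewrite divr_ge0 ?(ltW A_gt0)// (le_trans _ xy)// ltW.
    by rewrite ler_pM2l// lef_pV2// posrE (lt_le_trans x_gt0).
  apply: fine_le; rewrite ?fin_num_measure//; exact: ccdf_nonincreasing.
have := hazard_ge x0x; have [->|F0] := eqVneq (fine (ccdf X x)) 0.
  by rewrite mulr0.
by rewrite ler_pdivlMr// lt_neqAle eq_sym F0 tail_ge0.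
Qed.

(** The interval has length a and the density on it is at least
    A / (2 a) times the tail at 2 a. *)
Lemma prob_dyadic_ge_tail a : x0 <= a ->
  ((A / 2 * fine (ccdf X (2 * a)))%:E <=
   P (X @^-1` `]a, (2 * a)%R]%classic))%E.
Proof.
move=> x0a; have a_gt0 : 0 < a by exact: lt_le_trans x0a.
apply: le_trans (@density_lower_bound _ _ _ P X f
  (A / (2 * a) * fine (ccdf X (2 * a))) (`]a, (2 * a)%R]%classic : set R)
  Xf _ _ _) => //.
- rewrite lebesgue_measure_itv /= lte_fin ltr_pMl// ltr1n -EFinD -EFinM lee_fin.
  by rewrite le_eqVlt; apply/orP; left; apply/eqP; field; rewrite gt_eqF.
- by rewrite mulr_ge0// divr_ge0// ltW// mulr_gt0.
- move=> x /=; rewrite in_itv /= => /andP[ax x2a].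
  by apply: density_ge_tail; rewrite x2a (le_trans x0a)// ltW.
Qed.

(** A power of x is absorbed by a change of the constant in the stretched
    exponential. *)
Lemma stretched_tail_ge (B alpha beta gamma : R) : 1 <= x0 -> 0 < B ->
  0 < beta ->
  (forall x, x0 <= x -> B * x `^ gamma * expR (- (alpha * x `^ beta))
    <= fine (ccdf X x)) ->
  forall x, x0 <= x ->
    B * expR (- ((alpha + `|gamma| / beta) * x `^ beta)) <= fine (ccdf X x).
Proof.
move=> x01 B0 beta0 tail_ge x x0x; apply: le_trans (tail_ge _ x0x).
have x1 : 1 <= x by exact: le_trans x0x.
rewrite -mulrA ler_pM2l// mulrDl opprD addrC expRD ler_wpM2r ?expR_ge0//.
apply: (@le_trans _ _ (x `^ (- `|gamma|))); last first.
  by rewrite ler_powR// lerNl -normrN ler_norm.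
rewrite expRN powRN lef_pV2 ?posrE ?expR_gt0 ?powR_gt0 ?(lt_le_trans ltr01)//.
exact: powR_le_expR.
Qed.

End tails.

(** * Lower bound for the law of the product *)

Lemma le_prode (R : realDomainType) (I : finType) (Q : pred I) (x : I -> R)
    (y : I -> \bar R) :
  (forall i, Q i -> 0 <= x i) -> (forall i, Q i -> ((x i)%:E <= y i)%E) ->
  ((\prod_(i | Q i) x i)%:E <= \prod_(i | Q i) y i)%E.
Proof.
move=> x0 xy.
suff [] : 0 <= \prod_(i | Q i) x i /\
    ((\prod_(i | Q i) x i)%:E <= \prod_(i | Q i) y i)%E by [].
apply: (big_rec2 (fun a b => 0 <= a /\ (a%:E <= b)%E)) => [//|i a b Qi [a0 ab]].
split; first by rewrite mulr_ge0 ?x0.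
by rewrite EFinM lee_pmul ?lee_fin ?x0 ?xy.
Qed.

(** The factors other than X j stay in their dyadic boxes, which confines their
    product v to a range where t / v lies between a_j / 2^|I| and a_j. There
    the density of X j is at least its value at 2 a_j, by monotonicity for
    positive x and by symmetry for negative x; the remaining factor t / v of the
    dilation cancels the 1 / a_j of the hazard rate bound. *)
Lemma dilate_prod_minorant d (T : measurableType d) (R : realType)
    (P : probability T R) (I : finType) (X : I -> {RV P >-> R})
    (f : I -> R -> R) (x0 : R) (A a : I -> R) (j : I) (S : set R) :
  mutually_independent X -> (forall i, has_density (X i) (f i)) -> 0 < x0 ->
  (forall i, 0 < A i) ->
  (forall i x, x0 <= x -> A i / x <= f i x / fine (ccdf (X i) x)) ->
  (forall x, f j (- x) = f j x) ->
  {in `[x0, +oo[ &, nonincreasing_fun (f j)} ->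
  (forall i, 2 ^+ #|I| * x0 <= a i) -> measurable S ->
  (((2 ^+ #|I|)^-1 * \prod_i (A i / 2 * fine (ccdf (X i) (2 * a i))))%:E *
     dilate (@shell_measure R) (\prod_i a i) S <=
   P [set w | S (\prod_i X i w)%R])%E.
Proof.
move=> X_indep Xf x0_gt0 A_gt0 hazard fj_sym fj_decr a_ge mS.
have pow_gt0 : 0 < 2 ^+ #|I| :> R by rewrite exprn_gt0.
have a_ge_x0 i : x0 <= a i.
  by apply: le_trans (a_ge i); rewrite ler_peMl ?(ltW x0_gt0)// exprn_ege1// ler1n.
have a_gt0 i : 0 < a i by exact: lt_le_trans (a_ge_x0 i).
have F_ge0 i x : 0 <= fine (ccdf (X i) x) by exact/fine_ge0/measure_ge0.
pose a' := \prod_(i | i != j) a i.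
have a'_gt0 : 0 < a' by exact: prodr_gt0.
have aE : \prod_i a i = a j * a' by rewrite (bigD1 j).
pose F i := A i / 2 * fine (ccdf (X i) (2 * a i)).
have F0 i : 0 <= F i by rewrite mulr_ge0// divr_ge0// ltW.
pose D := dilate (@shell_measure R) (\prod_i a i) S.
have D0 : (0 <= D)%E by exact: measure_ge0.
pose h := (((2 ^+ #|I|)^-1 * F j)%:E * D)%E.
have h0 : (0 <= h)%E by rewrite mule_ge0// lee_fin mulr_ge0// invr_ge0 ltW.
pose box i : set R := `]a i, (2 * a i)]%classic.
apply: (@le_trans _ _ (h * \prod_(i | i != j) P (X i @^-1` box i))%E).
  rewrite (bigD1 j)//= -/(F j) mulrA EFinM muleAC -/D.
  apply: lee_wpmul2l => //; apply: le_prode => i _; first exact: F0.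
  exact: (prob_dyadic_ge_tail (Xf i) x0_gt0 (A_gt0 i) (hazard i)).
pose S' : set (R * R) := (fun vy => vy.1 * vy.2) @^-1` S.
have mS' : measurable S'.
  rewrite -[X in measurable X]setTI.
  have : measurable_fun setT (fun vy : R * R => vy.1 * vy.2).
    by apply: measurable_funM; [exact: measurable_fst|exact: measurable_snd].
  exact.
have -> : [set w | S (\prod_i X i w)%R] =
    [set w | S' ((\prod_(i | i != j) X i w)%R, X j w)].
  have XE w : \prod_i X i w = (\prod_(i | i != j) X i w) * X j w.
    by rewrite (bigD1 j)//= mulrC.
  by apply/seteqP; split => w; rewrite /S' /= XE.
apply: (@le_prob_box_prod _ _ _ _ _ _ _ X_indep box S' h
    `[a', (2 ^+ #|I| * a')]%classic) => //.
- by move=> i; exact: measurable_itv.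
- move=> w Xw; rewrite /= in_itv /=; apply/andP; split.
    apply: ler_prod => i ij; have := Xw i ij; rewrite /box /= in_itv /=.
    by move=> /andP[/ltW -> _]; rewrite ltW.
  apply: (@le_trans _ _ (\prod_(i | i != j) (2 * a i))).
    apply: ler_prod => i ij; have := Xw i ij; rewrite /box /= in_itv /=.
    by move=> /andP[aX ->]; rewrite (le_trans _ (ltW aX))// ltW.
  rewrite big_split /= prodr_const ler_wpM2r ?(ltW a'_gt0)//.
  by rewrite ler_weXn2l ?ler1n// max_card.
move=> v; rewrite /= in_itv /= => /andP[av va].
have v_gt0 : 0 < v by exact: lt_le_trans av.
have t_gt0 : 0 < \prod_i a i by exact: prodr_gt0.
have tv_le : (\prod_i a i) / v <= a j.
  by rewrite ler_pdivrMr// aE ler_pM2l.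
have tv_ge : a j / 2 ^+ #|I| <= (\prod_i a i) / v.
  rewrite aE ler_pdivlMr// -mulrA ler_pM2l// mulrC ler_pdivrMr//.
  by rewrite mulrC.
have x0_tv : x0 <= (\prod_i a i) / v.
  by apply: le_trans tv_ge; rewrite ler_pdivlMr// mulrC.
pose c := A j / (2 * a j) * fine (ccdf (X j) (2 * a j)).
have c0 : 0 <= c by rewrite mulr_ge0// divr_ge0// ltW// mulr_gt0.
have := @dilate_shell_minorant _ _ _ P (X j) (f j) c _ v S (Xf j) c0 t_gt0 v_gt0 mS.
have -> : xsection S' v = *%R v @^-1` S.
  by apply/seteqP; split => y; rewrite /xsection /= inE.
move=> minorant; apply: le_trans (minorant _); last first.
  move=> x /andP[x_ge x_le].
  have x_le' : `|x| <= 2 * a j by apply: le_trans x_le _; rewrite ler_pM2l.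
  have fE : f j x = f j `|x| by case: (ler0P x) => // _; rewrite fj_sym.
  rewrite fE; apply: (density_ge_tail (Xf j) x0_gt0 (A_gt0 j) (hazard j)).
  by rewrite x_le' (le_trans x0_tv).
rewrite lee_wpmul2r// lee_fin.
apply: (@le_trans _ _ (c * (a j / 2 ^+ #|I|))); last by rewrite ler_wpM2l.
rewrite /c /F le_eqVlt; apply/orP; left; apply/eqP; field.
by rewrite !gt_eqF.
Qed.

Theorem theorem11 (R : realType) (d : measure_display) (T : measurableType d)
  (P : probability T R) (n0 n : nat) (n0_ge1 : (1 <= n0)%N) (n0_lt_n : (n0 < n)%N)
  (xi : 'I_n -> {RV P >-> R})
  (xi_indep : mutually_independent xi)
  (xi_moments : forall i, finite_moments P (xi i))
  (xi_ge0 : forall i : 'I_n, (i < n0)%N -> {ae P, forall w, 0 <= xi i w})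
  (f : 'I_n -> R -> R)
  (f_density : forall i, has_density (xi i) (f i))
  (f_gt0_half : forall i : 'I_n, (i < n0)%N -> forall x, 0 < x -> 0 < f i x)
  (f_gt0_line : forall j : 'I_n, (n0 <= j)%N -> forall x, 0 < f j x)
  (f_sym : forall j : 'I_n, (n0 <= j)%N -> forall x, f j (- x) = f j x)
  (x0 : R) (x0_ge1 : 1 <= x0)
  (f_decr : exists2 j : 'I_n, (n0 <= j)%N &
     {in `[x0, +oo[ &, nonincreasing_fun (f j)})
  (A B alpha beta gamma : 'I_n -> R)
  (A_gt0 : forall i, 0 < A i) (B_gt0 : forall i, 0 < B i)
  (alpha_gt0 : forall i, 0 < alpha i) (beta_gt0 : forall i, 0 < beta i)
  (hazard_ge : forall i x, x0 <= x -> A i / x <= f i x / fine (ccdf (xi i) x))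
  (tail_ge : forall i x, x0 <= x ->
     B i * x `^ gamma i * expR (- (alpha i * x `^ beta i))
       <= fine (ccdf (xi i) x))
  (sum_beta : 1 < \sum_(i < n) (beta i)^-1) :
  M_indet P (fun w => \prod_(i < n) xi i w).
Proof.
have [j n0_le_j fj_decr] := f_decr.
have x0_gt0 : 0 < x0 by exact: lt_le_trans x0_ge1.
have mZ : measurable_fun setT (fun w => \prod_(i < n) xi i w).
  exact: measurable_fun_prod_RV.
pose Z : {RV P >-> R} := mfun_Sub (mem_set mZ).
have fmZ : finite_moments P Z by exact: finite_moments_prod.
pose b := (\sum_(i < n) (beta i)^-1)^-1.
have sum_gt0 : 0 < \sum_(i < n) (beta i)^-1 by exact: lt_trans sum_beta.
have b_gt0 : 0 < b by rewrite invr_gt0.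
have b01 : 0 < b < 1 by rewrite b_gt0 invf_lt1.
(* With a_i = t^(p i) the tails of all the factors at a_i decay at the same
   stretched exponential rate b in t. *)
pose p i := b / beta i.
have p_gt0 i : 0 < p i by rewrite divr_gt0.
have p_sum : \sum_i p i = 1 by rewrite -mulr_sumr mulVf// gt_eqF.
have p_beta i : p i * beta i = b by rewrite divfK// gt_eqF.
pose m := 2 ^+ #|'I_n| * x0.
have m_gt0 : 0 < m by rewrite mulr_gt0// exprn_gt0.
(* From L on, each a_i / 2^n is at least x0. *)
pose L := 1 + \sum_i m `^ (p i)^-1.
have L_gt0 : 0 < L by rewrite ltr_pwDl// sumr_ge0// => i _; exact: powR_ge0.
pose alpha' i := alpha i + `|gamma i| / beta i.
have alpha'_ge0 i : 0 <= alpha' i.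
  by rewrite addr_ge0 ?divr_ge0// ltW.
pose c := (2 ^+ #|'I_n|)^-1 * \prod_i (A i / 2 * B i).
have c_gt0 : 0 < c.
  rewrite mulr_gt0 ?invr_gt0 ?exprn_gt0// prodr_gt0// => i _.
  by rewrite mulr_gt0// divr_gt0.
pose C := \sum_i alpha' i * 2 `^ beta i.
have C_ge0 : 0 <= C by rewrite sumr_ge0// => i _; rewrite mulr_ge0// powR_ge0.
apply: (@M_indet_of_dilate_minorant _ _ _ P Z (@shell_measure R) L c C b) => //.
- exact: shell_measure_sym.
- exact: shell_measure_even_moment_fin.
- exact: shell_measure_unit.
- exact: shell_measure_gt0.
move=> t Lt S mS; have t_gt0 : 0 < t by exact: lt_le_trans Lt.
have a_ge i : m <= t `^ p i.
  have <- : (m `^ (p i)^-1) `^ p i = m.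
    by rewrite -powRrM mulVf ?powRr1 ?(ltW m_gt0)// gt_eqF.
  rewrite ge0_ler_powR ?nnegrE ?powR_ge0 ?(ltW t_gt0) ?(ltW (p_gt0 i))//.
  apply: le_trans Lt; rewrite ler_wpDl// (bigD1 i)//= lerDl sumr_ge0// => k _.
  exact: powR_ge0.
have tE : t = \prod_i t `^ p i by rewrite -powR_sum// p_sum powRr1 ?ltW.
have := @dilate_prod_minorant _ _ _ P _ xi f x0 A (fun i => t `^ p i) j S
  xi_indep f_density x0_gt0 A_gt0 hazard_ge (f_sym j n0_le_j) fj_decr a_ge mS.
rewrite -tE; apply: le_trans; rewrite lee_wpmul2r// lee_fin.
rewrite /c -mulrA ler_pM2l ?invr_gt0 ?exprn_gt0//.
have -> : expR (- (C * t `^ b)) =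
    \prod_i expR (- (alpha' i * (2 * t `^ p i) `^ beta i)).
  rewrite -expR_sum /C mulr_suml -sumrN; congr expR; apply: eq_bigr => i _.
  by rewrite powRM ?powR_ge0// -powRrM p_beta mulrA.
rewrite -big_split /=; apply: ler_prod => i _.
rewrite !mulr_ge0 ?divr_ge0 ?expR_ge0 ?(ltW (A_gt0 i)) ?(ltW (B_gt0 i))//=.
rewrite -[leLHS]mulrA ler_pM2l ?divr_gt0//.
apply: (@stretched_tail_ge _ _ _ P (xi i) x0) => //; first exact: tail_ge.
apply: (@le_trans _ _ m).
  by rewrite ler_peMl ?(ltW x0_gt0)// exprn_ege1// ler1n.
by apply: le_trans (a_ge i) _; rewrite ler_peMl ?powR_ge0// ler1n.
Qed.
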